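(* The numbers $E_3(n)$ of partitions of $[n]$ having no enhanced $3$-crossing satisfy $E_3(0)=E_3(1)=1$ and, for all $n\ge 0$, $$8(n+3)(n+1)\,E_3(n)+\left(7n^2+53n+88\right)E_3(n+1)-(n+8)(n+7)\,E_3(n+2)=0.$$ Equivalently, the generating function $\mathcal{E}(t)=\sum_{n\ge 0}E_3(n)t^n$ satisfies $$t^2(1+t)(1-8t)\frac{d^2}{dt^2}\mathcal{E}(t)+2t\left(6-23t-20t^2\right)\frac{d}{dt}\mathcal{E}(t)+6\left(5-7t-4t^2\right)\mathcal{E}(t)-30=0.$$ Finally, as $n$ goes to infinity, $$E_3(n)\sim \frac{2^{16}\cdot 5}{3^3}\,\frac{\sqrt 3}{\pi}\,\frac{8^n}{n^7}.$$
   Context: A partition of $[n]=\{1,2,\ldots,n\}$ is a collection of nonempty, mutually disjoint subsets (blocks) of $[n]$ whose union is $[n]$ (there is exactly one partition of $[0]=\emptyset$). The standard representation of a partition $P$ of $[n]$ is the graph on vertex set $[n]$ whose edges are the pairs $(i,j)$ with $i<j$ such that $i$ and $j$ are in the same block of $P$ and are consecutive in that block (no element of the block lies strictly between $i$ and $j$). For the enhanced notion, one first adds a loop $(i,i)$ at every isolated point $i$ of this graph (i.e. every $i$ such that $\{i\}$ is a block). An enhanced $k$-crossing of $P$ is a collection of $k$ edges $(i_1,j_1),\ldots,(i_k,j_k)$ of the resulting graph such that $i_1<i_2<\cdots<i_k\le j_1<j_2<\cdots<j_k$. $E_3(n)$ denotes the number of partitions of $[n]$ having no enhanced $3$-crossing.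 *)

(* Defs.v *)
From HB Require Import structures.
From mathcomp Require Import all_boot all_order all_algebra.
From mathcomp Require Import all_classical all_reals all_analysis.
Set Implicit Arguments.
Unset Strict Implicit.
Unset Printing Implicit Defensive.

Import Order.TTheory GRing.Theory Num.Theory.
Import numFieldNormedType.Exports.

(* The ground set {1, ..., n} is represented by 'I_n = {0, ..., n-1}; only the
   order of the elements matters.  A set partition is a {set {set 'I_n}}
   satisfying [finset.partition]. *)

Section EnhancedCrossings.
Variable n : nat.
Implicit Type P : {set {set 'I_n}}.

Definition std_edge P (i j : 'I_n) : bool :=
  (i < j)%N &&
  [exists B in P, [&& i \in B, j \in B &
                      [forall m in B, ~~ ((i < m)%N && (m < j)%N)]]].

Definition enhanced_edge P (i j : 'I_n) : bool :=
  std_edge P i j || ((i == j) && ([set i]%SET \in P)).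

(* The condition i_k <= j_1 of the chain i_1 < ... < i_k <= j_1 < ... < j_k is
   the last clause; edges are indexed from 0 to k-1. *)
Definition is_enhanced_crossing k P (i j : {ffun 'I_k -> 'I_n}) : bool :=
  [&& [forall a, enhanced_edge P (i a) (j a)],
      [forall a : 'I_k, forall b : 'I_k,
         (a < b)%N ==> ((i a < i b)%N && (j a < j b)%N)] &
      [forall a : 'I_k, forall b : 'I_k,
         ((a.+1 == k) && (b == 0 :> nat)) ==> (i a <= j b)%N]].

Definition has_enhanced_crossing k P : bool :=
  [exists i : {ffun 'I_k -> 'I_n}, exists j : {ffun 'I_k -> 'I_n},
     is_enhanced_crossing P i j].

End EnhancedCrossings.

Definition E3 (n : nat) : nat :=
  #|[set P : {set {set 'I_n}} | finset.partition P [set: 'I_n]%SET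
                                & ~~ has_enhanced_crossing 3 P]%SET|.

Local Open Scope ring_scope.

(* A formal power series is given by its sequence of coefficients; sums and
   differences are the pointwise \+ and \-. *)
Section FormalPowerSeries.
Variable R : comNzRingType.

Definition fps := nat -> R.

Definition fps_poly (p : {poly R}) : fps := fun m => p`_m.

Definition fps_mul (a b : fps) : fps :=
  fun m => \sum_(i < m.+1) a i * b (m - i)%N.

Definition fps_deriv (a : fps) : fps := fun m => a m.+1 *+ m.+1.

End FormalPowerSeries.

Definition E3_gf : fps int := fun n => (E3 n)%:Z.

(* Main.v *)
(* Reading a partition from left to right, the absence of enhanced 3-crossings only
   restricts which open arc may be closed next, and the set of continuations depends
   only on the pattern of closable arcs among the open ones. Giving each pattern a
   polynomial weight linearizes this transfer: the number of completions pairs the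
   weight with a function of two integers that evolves by the walk with steps
   2 (0,0), +-(1,0), +-(0,1), +-(1,-1) killed on the walls of a Weyl chamber of order
   12. By reflection E_3(n) is a signed sum of 12 free walk counts, each of which is
   a sum of products of three binomial coefficients.

   Zeilberger's algorithm turns this sum into a combination of the Franel numbers
   f(n) = sum_k C(n,k)^3, so Franel's recurrence yields that of E_3, and conversely
   f(n+5) is a combination of E_3(n) and E_3(n+1) with polynomial coefficients.

   By MacMahon, f(n) = sum_k C(n+k,3k) (3k)!/k!^3 2^(n-2k), where (3k)!/k!^3 is
   asymptotic to sqrt 3 / (2 pi) 27^k / k by the product formula for the sine; with
   this replacement the sum obeys a first-order recurrence, so that
   f(n) ~ 2 / (sqrt 3 pi) 8^n / n. Finally 8n/(n+8) <= E_3(n+1)/E_3(n) <= 8 by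
   induction, and E_3(n) is recovered from f(n+5). *)

Require Import Defs.
From HB Require Import structures.
From mathcomp Require Import all_boot all_order all_algebra.
From mathcomp Require Import all_classical all_reals all_analysis.
From mathcomp Require Import zify ring lra.
Import Order.TTheory GRing.Theory Num.Theory.
Import numFieldNormedType.Exports.
Set Implicit Arguments.
Unset Strict Implicit.
Unset Printing Implicit Defensive.

(** The relation [chamber_count_franel] cannot carry the asymptotics: its two Franel terms are of
    order 8^n n^4 but their difference is only of order 8^n n, so the leading term of the Franel
    numbers cancels. In the converse relation both coefficients are positive and nothing cancels:
    after division by E_3(n) only the limit 8 of E_3(n+1) / E_3(n) is needed, and the leading
    coefficients 3 and 3 give 3 + 3 * 8 = 27, the 3^3 of the statement.

    On the combinatorial side, the weight of a pattern of N arcs has degree N, so the points (N - j,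
    j) that it is paired with leave the chamber i >= j >= 0. The signed count is therefore kept on
    the whole plane, where its antisymmetry removes exactly the terms by which the transfer of
    weights fails to be the step operator of the walk.

    The sine product is reached through explicit antiderivatives, compared by the signs of their
    derivatives. *)

(** * Words of a left-to-right reading, and the transfer between patterns of closable arcs *)

Section NoncrossingWords.
Import mathcomp.boot.finset.
Local Open Scope nat_scope.

(* A partition is read from left to right: the letter of a point records whether
   an arc leaves it and the origin of the arc entering it; a loop does both. *)
Definition letter : eqType := (bool * option nat)%type.
Implicit Types (w p : seq letter) (l : letter) (b : seq bool).

Definition opens w i := (nth (false, None) w i).1.
Definition source w j := (nth (false, None) w j).2.
Definition closed_arc w i := has (fun l => l.2 == Some i) w.
Definition open_arcs w := [seq i <- iota 0 (size w) | opens w i && ~~ closed_arc w i].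

(* When x < y are both open and an arc of [w] starts before x and ends at or after y,
   closing x before y would complete an enhanced 3-crossing. *)
Definition blocks w x y :=
  has (fun j => if source w j is Some i then (i < x) && (y <= j) else false)
      (iota 0 (size w)).

(** The point being read has index [size w]. When it opens an arc it joins the list, and choosing it
    closes it at once: this is how a loop is read. *)
Definition candidates w (o : bool) := open_arcs w ++ nseq o (size w).

Definition closable w (o : bool) i :=
  ~~ has (fun y => (i < y) && blocks w i y) (candidates w o).

Definition admissible w l :=
  if l.2 is Some i then (i \in candidates w l.1) && closable w l.1 i else l.1.

Fixpoint accepts p w :=
  if w is l :: w' then admissible p l && accepts (rcons p l) w'
  else nilp (open_arcs p).

Definition letters p : seq letter :=
  (true, None)
  :: [seq (false, Some i) | i <- candidates p false & closable p false i]
  ++ [seq (true, Some i) | i <- candidates p true & closable p true i].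

Fixpoint words m p : seq (seq letter) :=
  if m is m'.+1 then
    flatten [seq [seq l :: w | w <- words m' (rcons p l)] | l <- letters p]
  else if nilp (open_arcs p) then [:: [::]] else [::].

Lemma mem_letters p l : (l \in letters p) = admissible p l.
Proof.
have key (o o' : bool) (i : nat) : ((o, Some i) \in
    [seq (o', Some i) | i <- candidates p o' & closable p o' i])
    = (o == o') && ((i \in candidates p o) && closable p o i).
  apply/mapP/idP => [[j]|/andP[/eqP <- h]].
    by rewrite mem_filter => /andP[cj ji] [-> ->]; rewrite eqxx cj ji.
  by exists i => //; rewrite mem_filter andbC.
rewrite /admissible /letters inE mem_cat; case: l => o [i|] /=.
  by rewrite !key; case: o => //=; rewrite ?orbF.
rewrite /= !(introF mapP) ?orbF; first by case: o.
- by case=> j _ [].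
- by case=> j _ [].
Qed.

Lemma wordsS m p :
  words m.+1 p
  = flatten [seq [seq l :: w | w <- words m (rcons p l)] | l <- letters p].
Proof. by []. Qed.

Lemma mem_words m p w : (w \in words m p) = (size w == m) && accepts p w.
Proof.
elim: m p w => [|m IH] p w.
  rewrite [words _ _]/=; case: ifP => e; rewrite ?inE; case: w => [|l w] //=.
rewrite wordsS; apply/flatten_mapP/idP => [[l]|].
  rewrite mem_letters => al /mapP[v]; rewrite IH => /andP[sv av] ->.
  by rewrite /= eqSS sv al av.
case: w => // l w; rewrite /= eqSS => /and3P[sw al aw]; exists l; first by rewrite mem_letters.
by apply: map_f; rewrite IH sw.
Qed.

Lemma uniq_open_arcs w : uniq (open_arcs w).
Proof. by rewrite filter_uniq ?iota_uniq. Qed.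

Lemma ltn_open_arcs w : all (fun i => i < size w) (open_arcs w).
Proof. by apply/allP => i; rewrite mem_filter mem_iota => /and3P[]. Qed.

Lemma uniq_candidates w o : uniq (candidates w o).
Proof.
rewrite cat_uniq uniq_open_arcs /=; case: o => //=; rewrite orbF andbT.
by apply/negP => /(allP (ltn_open_arcs w)); rewrite ltnn.
Qed.

Lemma uniq_words m p : uniq (words m p).
Proof.
elim: m p => [|m IH] p; first by rewrite /=; case: ifP.
have flat (s : seq letter) : uniq s ->
    uniq (flatten [seq [seq l :: w | w <- words m (rcons p l)] | l <- s]).
  elim: s => //= l s IHs /andP[ls us]; rewrite cat_uniq IHs // andbT.
  rewrite map_inj_uniq ?IH //=; last by move=> ? ? [].
  apply/hasPn => v /flatten_mapP[l' l's /mapP[v' _ ->]].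
  by apply/mapP => -[v'' _ [ll' _]]; move: ls; rewrite -ll' l's.
have inj (o : bool) : injective (fun i : nat => (o, Some i)) by move=> ? ? [].
rewrite wordsS; apply: flat; rewrite /letters /= cat_uniq !map_inj_uniq ?filter_uniq ?uniq_candidates //.
rewrite !andbT; apply/andP; split.
  by rewrite mem_cat; apply/norP; split; apply/mapP => -[].
by apply/hasPn => l /mapP[i _ ->]; apply/mapP => -[].
Qed.

(* Only the pattern of closable arcs matters for the continuations of a prefix:
   [marks] lists the open arcs in increasing order, each with the bit saying
   whether it may be closed next. *)
Fixpoint marks (e : rel nat) (s : seq nat) : seq bool :=
  if s is x :: s' then (if s' is y :: _ then ~~ e x y else true) :: marks e s'
  else [::].

(** The pattern of arcs that all start after the arc just closed: that arc starts before and ends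
    after each of these starts, so any two of them conflict and only the last remains closable. *)
Definition tail_marks n := if n is n'.+1 then rcons (nseq n' false) true else [::].

(** Arcs to the left of the closed one keep their marks, except its neighbour, which becomes
    closable: whatever made the neighbour conflict with an arc further right would also have made
    the closed arc unclosable. *)
Fixpoint close b q : seq bool :=
  if b is x :: b' then
    if q is q'.+1 then (x || (q' == 0)) :: close b' q' else tail_marks (size b')
  else [::].

(** The summands are the next points that only open, only close, or do both. In the last case the
    new arc is appended before the choice, so that choosing the last index is a loop. *)
Fixpoint completions m b : nat :=
  if m is m'.+1 then
    completions m' (rcons b true)
    + \sum_(q < size b | nth false b q) completions m' (close b q)
    + \sum_(q < size (rcons b true) | nth false (rcons b true) q)
        completions m' (close (rcons b true) q)
  else nilp b.

Lemma size_marks e s : size (marks e s) = size s.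
Proof. by elim: s => //= x s ->. Qed.

Lemma marks_rcons (e : rel nat) s x : (forall y, e y x = false) ->
  marks e (rcons s x) = rcons (marks e s) true.
Proof.
move=> ex; elim: s => //= y s ->; congr cons.
by case: s => //=; rewrite ex.
Qed.

Lemma marks_true (e : rel nat) s : (forall x y, x \in s -> y \in s -> e x y) ->
  marks e s = tail_marks (size s).
Proof.
elim: s => //= x s IH h; rewrite IH.
  by case: s h {IH} => //= y s h; rewrite h ?inE ?eqxx ?orbT.
by move=> a b ha hb; apply: h; rewrite inE ?ha ?hb orbT.
Qed.

Lemma eq_in_marks (e e' : rel nat) s : {in s &, e =2 e'} -> marks e s = marks e' s.
Proof.
elim: s => //= x s IH h; rewrite IH.
  by case: s h {IH} => // y s ->; rewrite ?inE ?eqxx ?orbT.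
by move=> a b ha hb; apply: h; rewrite inE ?ha ?hb orbT.
Qed.

Lemma marks_close (e e' : rel nat) s1 x s2 :
  {in s1 & s1 ++ x :: s2, e =2 e'} -> {in s1 & s2, forall y z, ~~ e y z} ->
  {in s2 &, forall y z, e' y z} ->
  marks e' (s1 ++ s2) = close (marks e (s1 ++ x :: s2)) (size s1).
Proof.
elim: s1 => [|y s1 IH] h1 h2 h3 /=; first by rewrite size_marks marks_true.
rewrite -IH //; last 2 first.
- by move=> a b ha hb; apply: h1; rewrite inE ?ha ?hb orbT.
- by move=> a b ha hb; apply: h2; rewrite // inE ha orbT.
congr cons; case: s1 h1 h2 {IH} => [|z s1] h1 h2 /=; last first.
  by rewrite orbF h1 // ?inE ?eqxx ?orbT.
rewrite orbT; case: s2 h1 h2 h3 => // z s2 h1 h2 h3.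
by rewrite -h1 ?inE ?eqxx ?orbT // h2 ?inE ?eqxx.
Qed.

(** By monotonicity in the second argument, a conflict with any later arc entails one with the
    immediate successor, the only arc that [marks] inspects. *)
Lemma nth_marks (e : rel nat) s q :
  (forall x y z, e x z -> y <= z -> e x y) -> pairwise ltn s -> q < size s ->
  nth false (marks e s) q
  = ~~ has (fun y => (nth 0 s q < y) && e (nth 0 s q) y) s.
Proof.
move=> mono; elim: s q => // x s IH [|q] /= /andP[xs ss] qs.
  rewrite ltnn /=; case: s xs ss {IH qs} => //= y s /andP[xy xs] /andP[ys ss].
  rewrite xy /= negb_or; case exy: (e x y) => //=; symmetry.
  apply/hasPn => z zs; apply/negP => /andP[_ exz]; move: exy.
  by rewrite (mono x y z) // ltnW //; apply: (allP ys).
rewrite IH //; suff /negbTE -> : ~~ (nth 0 s q < x) by [].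
by rewrite -leqNgt ltnW //; apply: (allP xs); rewrite mem_nth.
Qed.

Lemma iota_rcons m n : iota m n.+1 = rcons (iota m n) (m + n).
Proof. by rewrite -addn1 iotaD cats1. Qed.

Lemma source_rcons p l j :
  source (rcons p l) j = if j == size p then l.2 else source p j.
Proof.
rewrite /source nth_rcons; case: ltngtP => // h.
by rewrite nth_default // ltnW.
Qed.

Lemma opens_rcons p l i :
  opens (rcons p l) i = if i == size p then l.1 else opens p i.
Proof.
rewrite /opens nth_rcons; case: ltngtP => // h.
by rewrite nth_default // ltnW.
Qed.

Lemma closed_rcons p l i : closed_arc (rcons p l) i = closed_arc p i || (l.2 == Some i).
Proof. by rewrite /closed_arc has_rcons orbC. Qed.

Lemma blocks_rcons p o c x y :
  blocks (rcons p (o, c)) x y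
  = blocks p x y || (if c is Some i then (i < x) && (y <= size p) else false).
Proof.
rewrite /blocks size_rcons iota_rcons has_rcons add0n source_rcons eqxx orbC.
congr (_ || _); apply: eq_in_has => j; rewrite mem_iota => /andP[_ jp].
by rewrite source_rcons ltn_eqF.
Qed.

Lemma blocks_leq p x y z : blocks p x z -> y <= z -> blocks p x y.
Proof.
move=> /hasP[j ji]; case E : (source p j) => [i|] // /andP[ix zj] yz.
by apply/hasP; exists j; rewrite // E ix (leq_trans yz).
Qed.

Lemma blocks_geq p x y z : blocks p x z -> x <= y -> blocks p y z.
Proof.
move=> /hasP[j ji]; case E : (source p j) => [i|] // /andP[ix zj] xy.
by apply/hasP; exists j; rewrite // E zj (leq_trans ix).
Qed.

(** Arcs already drawn end before the point being read, so a newly opened arc never prevents the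
    closing of another. *)
Lemma blocks_size p x : blocks p x (size p) = false.
Proof.
apply/negbTE/hasPn => j; rewrite mem_iota => /andP[_ jp].
by case: source => // i; rewrite (leqNgt _ j) jp andbF.
Qed.

Lemma candidates0 p : candidates p false = open_arcs p.
Proof. exact: cats0. Qed.

Lemma candidates_leq p o i : i \in candidates p o -> i <= size p.
Proof.
rewrite mem_cat => /orP[/(allP (ltn_open_arcs p))/ltnW //|].
by rewrite mem_nseq => /andP[_ /eqP ->].
Qed.

Lemma pairwise_candidates p o : pairwise ltn (candidates p o).
Proof.
rewrite pairwise_cat; apply/and3P; split; last by case: o.
  rewrite allrelC; apply/allrelP => x y; rewrite mem_nseq => /andP[_ /eqP ->].
  exact: (allP (ltn_open_arcs p)).
by rewrite -(sorted_pairwise ltn_trans) sorted_filter ?iota_ltn_sorted //; exact: ltn_trans.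
Qed.

(* Malformed words may close the arc of an opener that has not been read yet. *)
Definition wf p := forall i, size p <= i -> ~~ closed_arc p i.

Lemma open_arcs_rcons p o c : wf p ->
  open_arcs (rcons p (o, c)) = [seq i <- candidates p o | c != Some i].
Proof.
move=> wfp; rewrite /open_arcs size_rcons iota_rcons add0n filter_rcons.
rewrite opens_rcons eqxx closed_rcons /= (negbTE (wfp _ _)) //=.
rewrite /candidates filter_cat -cats1 -filter_predI.
have -> : [seq i <- iota 0 (size p) | opens (rcons p (o, c)) i
             & ~~ closed_arc (rcons p (o, c)) i]
        = [seq i <- iota 0 (size p) |
             predI (fun i => c != Some i) (fun i => opens p i && ~~ closed_arc p i) i].
  apply: eq_in_filter => i; rewrite mem_iota => /andP[_ ip].
  rewrite opens_rcons ltn_eqF // closed_rcons /= negb_or.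
  by case: (c == _); rewrite ?andbF ?andbT.
by case: o => /=; rewrite ?cats0 //; case: (c == _) => /=; rewrite ?cats0 ?cats1.
Qed.

Lemma wf_rcons p l : wf p -> admissible p l -> wf (rcons p l).
Proof.
move=> wfp al i; rewrite size_rcons closed_rcons => ip.
rewrite negb_or wfp ?(ltnW ip) //=; apply/eqP => li.
move: al; rewrite /admissible li => /andP[/candidates_leq]; lia.
Qed.

Lemma marks_open p : marks (blocks p) (candidates p true)
  = rcons (marks (blocks p) (candidates p false)) true.
Proof.
by rewrite /candidates /= cats1 cats0 marks_rcons // => y; rewrite blocks_size.
Qed.

Lemma marks_step p o q : wf p -> q < size (candidates p o) ->
    let x := nth 0 (candidates p o) q in let p' := rcons p (o, Some x) in
    closable p o x ->
  marks (blocks p') (open_arcs p') = close (marks (blocks p) (candidates p o)) q.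
Proof.
move=> wfp qs x p' xc; rewrite open_arcs_rcons //.
have := pairwise_candidates p o; have := @candidates_leq p o; move: xc; rewrite /closable.
have [s1 [s2 [-> ->]]] : exists s1 s2, candidates p o = s1 ++ x :: s2 /\ q = size s1.
  exists (take q (candidates p o)), (drop q.+1 (candidates p o)).
  by rewrite -drop_nth // cat_take_drop size_takel // ltnW.
move=> xc leq_size.
rewrite pairwise_cat /= => /and4P[/allrelP lt12 _ /allP lt2 _].
have lt1 y : y \in s1 -> y < x by move=> /lt12; apply; rewrite mem_head.
have lt1' y z : y \in s1 -> z \in s2 -> y < z.
  by move=> /lt12 h zs; apply: h; rewrite inE zs orbT.
have -> : [seq i <- s1 ++ x :: s2 | Some x != Some i] = s1 ++ s2.
  rewrite filter_cat /= eqxx /=; congr (_ ++ _); apply/all_filterP/allP => i.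
    by move=> /lt1 h; apply/eqP => -[E]; rewrite E ltnn in h.
  by move=> /lt2 h; apply/eqP => -[E]; rewrite E /= ltnn in h.
apply: marks_close => [y z ys zs|y z ys zs|y z ys zs].
- by rewrite blocks_rcons (ltnNge x) (ltnW (lt1 _ ys)) orbF.
- apply/negP => b; move/hasPn: xc => /(_ z).
  rewrite mem_cat inE zs !orbT => /(_ isT) /negP; apply.
  by rewrite [_ < _]lt2 //= (blocks_geq b) // ltnW // lt1.
- rewrite blocks_rcons [x < y]lt2 // leq_size ?orbT //.
  by rewrite mem_cat inE zs !orbT.
Qed.

Lemma size_words m p : wf p ->
  size (words m p) = completions m (marks (blocks p) (candidates p false)).
Proof.
elim: m p => [|m IH] p wfp.
  by rewrite /= /nilp size_marks candidates0; case: ifP.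
have IHl l : admissible p l -> size [seq l :: w | w <- words m (rcons p l)]
    = completions m (marks (blocks (rcons p l)) (open_arcs (rcons p l))).
  by move=> al; rewrite size_map IH ?candidates0 //; exact: wf_rcons.
rewrite wordsS size_flatten /shape -map_comp sumnE big_map /letters.
rewrite big_cons big_cat /= !big_map !big_filter addnA.
have sum o : \sum_(i <- candidates p o | closable p o i)
      size [seq (o, Some i) :: w | w <- words m (rcons p (o, Some i))]
    = \sum_(q < size (marks (blocks p) (candidates p o))
             | nth false (marks (blocks p) (candidates p o)) q)
        completions m (close (marks (blocks p) (candidates p o)) q).
  rewrite size_marks (big_nth 0) big_mkord; apply: eq_big => q.
    rewrite nth_marks ?pairwise_candidates //.
    by move=> x y z; apply: blocks_leq.
  by move=> cq; rewrite IHl ?marks_step // /admissible /= mem_nth.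
rewrite !sum -marks_open; congr (_ + _ + _).
rewrite IHl // open_arcs_rcons //= (eq_filter (a2 := predT)) ?filter_predT //.
congr completions; apply: eq_in_marks => x y _ _.
by rewrite blocks_rcons orbF.
Qed.

(** * Accepted words are the words of graphs without enhanced 3-crossing *)

Definition edge w i j := source w j == Some i.

Definition no3crossing (e : nat -> nat -> bool) := forall i1 i2 i3 j1 j2 j3,
  i1 < i2 < i3 -> i3 <= j1 -> j1 < j2 < j3 -> ~ [/\ e i1 j1, e i2 j2 & e i3 j3].

Definition valid w :=
  [/\ forall i j, edge w i j -> (i <= j) && opens w i,
      forall i j j', edge w i j -> edge w i j' -> j = j',
      forall i, opens w i -> exists j, edge w i j,
      forall j, j < size w -> opens w j || source w j
    & no3crossing (edge w)].

Lemma edge_size w i j : edge w i j -> j < size w.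
Proof. by rewrite /edge /source; case: ltnP => // h; rewrite nth_default. Qed.

Lemma opens_size w i : opens w i -> i < size w.
Proof. by rewrite /opens; case: ltnP => // h; rewrite nth_default. Qed.

Lemma closedP w i : reflect (exists j, edge w i j) (closed_arc w i).
Proof.
apply: (iffP (hasP)) => [[l lw /eqP li]|[j eij]].
  by exists (index l w); rewrite /edge /source nth_index // li.
by exists (nth (false, None) w j); rewrite ?mem_nth // (edge_size eij).
Qed.

Lemma edge_take t w i j : edge (take t w) i j = (j < t) && edge w i j.
Proof.
rewrite /edge /source; case: ltnP => h; first by rewrite nth_take.
by rewrite nth_default // size_take_min (leq_trans (geq_minl _ _)).
Qed.

Lemma opens_take t w i : opens (take t w) i = (i < t) && opens w i.
Proof.
rewrite /opens; case: ltnP => h; first by rewrite nth_take.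
by rewrite nth_default // size_take_min (leq_trans (geq_minl _ _)).
Qed.

Lemma blocksP w x y :
  reflect (exists i j, [/\ edge w i j, i < x & y <= j]) (blocks w x y).
Proof.
apply: (iffP hasP) => [[j _]|[i [j [eij ix yj]]]].
  case E: (source w j) => [i|] // /andP[ix yj].
  by exists i, j; split=> //; apply/eqP.
by exists j; rewrite ?mem_iota ?(edge_size eij) // (eqP eij) ix.
Qed.

Lemma acceptsE p w : accepts p w <->
  (forall t, t < size w -> admissible (p ++ take t w) (nth (false, None) w t))
  /\ nilp (open_arcs (p ++ w)).
Proof.
elim: w p => [|l w IH] p /=; first by rewrite cats0; split => // -[].
split=> [/andP[al /IH[h1 h2]]|[h1 h2]].
  rewrite -cat_rcons; split=> // -[|t] /= h; first by rewrite cats0.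
  by rewrite -cat_rcons h1.
apply/andP; split; first by have := h1 0 isT; rewrite cats0.
apply/IH; rewrite cat_rcons; split=> // t ht.
by have := h1 t.+1 ht; rewrite /= cat_rcons.
Qed.

(** An enhanced 3-crossing is detected at the end of its middle arc: the first arc is then already
    drawn, the third is still open and started no later than the end of the first, which is the
    situation that [closable] excludes. *)
Lemma accepts_valid w : accepts [::] w <-> valid w.
Proof.
have mem_cand t o i : t <= size w -> i \in candidates (take t w) o =
    ((i < t) && opens w i && ~~ closed_arc (take t w) i) || ((i == t) && o).
  move=> tw; rewrite mem_cat mem_nseq mem_filter mem_iota /= add0n size_takel //.
  by rewrite opens_take lt0b (andbC o); case: (i < t); rewrite ?andbF ?andbT.
rewrite acceptsE /=; split=> [[adm nil]|[v1 v2 v3 v4 v5]]; last first.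
  split=> [t tw|]; last first.
    rewrite /nilp size_filter -leqn0 leqNgt -has_count; apply/hasPn => i _.
    by rewrite negb_and negbK; case: opens (v3 i) => //= /(_ isT) /closedP.
  rewrite /admissible; case E: (_.2) => [i|]; last first.
    by have := v4 t tw; rewrite /opens /source E orbF.
  have /andP[it oi] := v1 i t (introT eqP E).
  have ltw := ltnW tw; rewrite mem_cand //; apply/andP; split.
    move: it; rewrite leq_eqVlt => /orP[/eqP it|it].
      by rewrite -it eqxx -[X in _ || X]/(opens w i) oi orbT.
    rewrite it oi /=; apply/orP; left; apply/closedP => -[j].
    rewrite edge_take => /andP[jt eij]; have := v2 _ _ _ eij (introT eqP E); lia.
  apply/hasPn => y; rewrite mem_cand // => hy; apply/negP => /andP[iy].
  move=> /blocksP[i1 [j1 [e1 i1i yj1]]]; move: e1; rewrite edge_take => /andP[j1t e1].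
  case/orP: hy => [/andP[/andP[yt oy] ncy]|/andP[/eqP yt _]]; last lia.
  have [j3 e3] := v3 _ oy.
  have j3t : t < j3.
    rewrite ltnNge leq_eqVlt; apply/negP => /orP[/eqP j3t|j3t].
      by move: e3; rewrite j3t /edge /source E => /eqP[] ?; lia.
    by move/closedP: ncy; apply; exists j3; rewrite edge_take j3t.
  apply: (v5 i1 i y j1 t j3); rewrite ?i1i ?iy ?j1t ?j3t //; split=> //.
  exact/eqP.
have v1 i j : edge w i j -> (i <= j) && opens w i.
  move=> e; have jw := edge_size e; have := adm j jw.
  rewrite /admissible -[_.2]/(source w j) (eqP e) mem_cand ?(ltnW jw) //.
  case/andP => /orP[/andP[/andP[ij ->] _]|/andP[/eqP-> oj]] _.
    by rewrite (ltnW ij).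
  by rewrite leqnn; exact: oj.
have v2' i j j' : edge w i j -> edge w i j' -> ~ j < j'.
  move=> e e' jj'; have jw := edge_size e'; have := adm j' jw.
  rewrite /admissible -[_.2]/(source w j') (eqP e') mem_cand ?(ltnW jw) //.
  have /andP[ij _] := v1 _ _ e.
  case/andP => /orP[/andP[_ /closedP[]]|/andP[/eqP ?]]; last lia.
  by exists j; rewrite edge_take jj'.
have v3 i : opens w i -> exists j, edge w i j.
  move=> oi; apply/closedP; move: nil; rewrite /nilp size_filter -leqn0 leqNgt -has_count.
  by move/hasPn => /(_ i); rewrite mem_iota (opens_size oi) oi negbK; apply.
split=> //.
- by move=> i j j' e e'; case: (ltngtP j j') => // /v2'; [case/(_ i)|case/(_ i)].
- move=> j jw; have := adm j jw; rewrite /admissible -[_.2]/(source w j).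
  by case: source => [i|] //; rewrite ?orbT ?orbF.
- move=> i1 i2 i3 j1 j2 j3 /andP[i12 i23] i3j1 /andP[j12 j23] [e1 e2 e3].
  have jw := edge_size e2; have := adm j2 jw.
  rewrite /admissible -[_.2]/(source w j2) (eqP e2) => /andP[_ /hasPn /(_ i3)].
  rewrite mem_cand ?(ltnW jw) // (leq_ltn_trans i3j1 j12) /=.
  have /andP[_ ->] := v1 _ _ e3.
  have -> : closed_arc (take j2 w) i3 = false.
    apply/negP => /closedP[j]; rewrite edge_take => /andP[jj2 e].
    by apply: (v2' i3 j j3) => //; lia.
  rewrite i23 => /(_ isT) /negP; apply; apply/blocksP; exists i1, j1.
  by rewrite edge_take j12.
Qed.

(* The minimum makes [prev] nonincreasing even on invalid words. *)
Definition prev w j := if source w j is Some i then minn i j else j.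

Lemma prev_leq w j : prev w j <= j.
Proof. by rewrite /prev; case: source => [i|] //; rewrite geq_minr. Qed.

Lemma prev_edge w i j : valid w -> edge w i j -> prev w j = i.
Proof.
by case=> v1 _ _ _ _ e; rewrite /prev (eqP e); apply/minn_idPl; case/andP: (v1 _ _ e).
Qed.

Lemma edge_prev w j : valid w -> prev w j != j -> edge w (prev w j) j.
Proof.
case=> v1 _ _ _ _; rewrite /edge /prev; case E: source => [i|]; last by rewrite eqxx.
by have /andP[/minn_idPl -> _] := v1 i j (introT eqP E).
Qed.

(** In a valid word, the least point of a block. Since [prev] strictly decreases until it is
    stationary, [size w] iterations reach a fixed point. *)
Definition block_root w := iter (size w) (prev w).

Lemma iter_prev_fix w n x : x <= n -> prev w (iter n (prev w) x) = iter n (prev w) x.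
Proof.
elim: n x => [|n IH] x xn; first by case: x xn => // _; apply/eqP; rewrite /= -leqn0 prev_leq.
have [px|px] := eqVneq (prev w x) x; first by elim: n.+1 => //= k IHk; rewrite !IHk.
by rewrite iterSr; apply: IH; have := prev_leq w x; lia.
Qed.

Lemma root_prev w x : x < size w -> block_root w (prev w x) = block_root w x.
Proof. by move=> xw; rewrite /block_root -iterSr /= iter_prev_fix // ltnW. Qed.

Lemma iter_prev_leq w k x : iter k (prev w) x <= x.
Proof. by elim: k => //= k; apply: leq_trans; apply: prev_leq. Qed.

Lemma prev_inj w x y : valid w -> prev w x != x -> prev w y != y ->
  prev w x = prev w y -> x = y.
Proof.
move=> vw px py pxy; have ex := edge_prev vw px; have ey := edge_prev vw py.
by case: vw => _ v2 _ _ _; apply: (v2 (prev w x)) => //; rewrite pxy.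
Qed.

(** Induction on [x]: the [prev] chain of [y] reaches [prev w x] by the induction hypothesis, and by
    [prev_inj] its last proper step into that point starts at [x]. *)
Lemma root_eq w x y : valid w -> x <= y -> y < size w -> block_root w x = block_root w y ->
  exists k, iter k (prev w) y = x.
Proof.
move=> vw; elim/ltn_ind: x y => x IH y xy yw rxy.
have [px|px] := eqVneq (prev w x) x.
  exists (size w); rewrite -/(block_root w y) -rxy /block_root.
  by elim: (size w) => //= k ->.
have ltx : prev w x < x by rewrite ltn_neqAle px prev_leq.
have xw := leq_ltn_trans xy yw.
have [] := IH _ ltx y (ltnW (leq_trans ltx xy)) yw; first by rewrite root_prev.
elim=> [|k IHk]; first by move=> /= E; move: ltx; rewrite -E; lia.
rewrite iterS; set z := iter k _ _; have [pz|pz] := eqVneq (prev w z) z.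
  by rewrite pz; apply: IHk.
by move=> pzx; exists k; apply: prev_inj pzx.
Qed.

(** * Bijection between partitions without enhanced 3-crossing and valid words *)

Section PartitionWord.
Variable n : nat.
Implicit Type P : {set {set 'I_n}}.

Definition same_block P (x y : 'I_n) := pblock P x == pblock P y.

Lemma mem_pblock_same P (x y : 'I_n) : finset.partition P [set: 'I_n] ->
  (y \in pblock P x) = same_block P x y.
Proof.
case/and3P => /eqP cP tP _; rewrite /same_block eq_pblock // cP ?in_setT //.
Qed.

Lemma std_edgeP P (i j : 'I_n) : finset.partition P [set: 'I_n] ->
  reflect [/\ i < j, same_block P i j
            & forall m : 'I_n, i < m < j -> ~~ same_block P i m] (std_edge P i j).
Proof.
move=> hP; have /and3P[/eqP cP tP _] := hP.
apply: (iffP andP) => [[ij /'exists_andP[B [BP /and3P[iB jB /forallP h]]]]|[ij sij h]].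
  have Bi : pblock P i = B by apply: def_pblock.
  split=> // [|m im]; first by rewrite -mem_pblock_same // Bi.
  by rewrite -mem_pblock_same // Bi; apply/negP => mB; have := h m; rewrite mB im.
split=> //; apply/existsP; exists (pblock P i).
rewrite pblock_mem ?cP ?in_setT //= mem_pblock cP in_setT /= mem_pblock_same // sij /=.
by apply/forall_inP => m; rewrite mem_pblock_same // => sim; apply/negP => /h; rewrite sim.
Qed.

Lemma loopP P (i : 'I_n) : finset.partition P [set: 'I_n] ->
  reflect (forall j, same_block P i j -> j = i) ([set i] \in P).
Proof.
move=> hP; have /and3P[/eqP cP tP _] := hP.
apply: (iffP idP) => [iP j|h].
  rewrite -mem_pblock_same // (def_pblock tP iP (set11 i)).
  by rewrite inE => /eqP.
suff -> : [set i] = pblock P i by rewrite pblock_mem // cP in_setT.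
apply/setP => j; rewrite inE mem_pblock_same //; apply/eqP/idP => [->|/h //].
exact: eqxx.
Qed.

Lemma same_blockC P x y : same_block P x y = same_block P y x.
Proof. exact: eq_sym. Qed.

Lemma same_block_trans P : transitive (same_block P).
Proof. by move=> y x z /eqP h1 /eqP h2; apply/eqP; rewrite h1. Qed.

Section OnePartition.
Variables (P : {set {set 'I_n}}) (hP : finset.partition P [set: 'I_n]).

Lemma enhanced_edge_leq i j : enhanced_edge P i j -> i <= j.
Proof.
by case/orP => [/(std_edgeP _ _ hP)[/ltnW]|/andP[/eqP ->]].
Qed.

Lemma enhanced_edge_same i j : enhanced_edge P i j -> same_block P i j.
Proof.
by case/orP => [/(std_edgeP _ _ hP)[]|/andP[/eqP -> _]] //; apply: eqxx.
Qed.

Lemma enhanced_edge_source i i' j :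
  enhanced_edge P i j -> enhanced_edge P i' j -> i = i'.
Proof.
case/orP => [/(std_edgeP _ _ hP)[ij sij hi]|/andP[/eqP -> /(loopP _ hP) li]];
case/orP => [/(std_edgeP _ _ hP)[ij' sij' hi']|/andP[/eqP -> /(loopP _ hP) li']] //.
- have sii : same_block P i i'.
    by apply: same_block_trans sij _; rewrite same_blockC.
  apply: val_inj; case: (ltngtP i i') => //= ii'.
    by have := hi i'; rewrite ii' ij' sii => /(_ isT).
  by have := hi' i; rewrite ii' ij same_blockC sii => /(_ isT).
- by apply: li'; rewrite same_blockC.
- by symmetry; apply: li; rewrite same_blockC.
Qed.

Lemma enhanced_edge_target i j j' :
  enhanced_edge P i j -> enhanced_edge P i j' -> j = j'.
Proof.
case/orP => [/(std_edgeP _ _ hP)[ij sij hi]|/andP[/eqP <- /(loopP _ hP) li]];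
case/orP => [/(std_edgeP _ _ hP)[ij' sij' hi']|/andP[/eqP <- /(loopP _ hP) li']] //.
- apply: val_inj; case: (ltngtP j j') => //= jj'.
    by have := hi' j; rewrite ij jj' sij => /(_ isT).
  by have := hi j'; rewrite ij' jj' sij' => /(_ isT).
- exact: li'.
- by symmetry; apply: li.
Qed.

Lemma ex_enhanced_edge_before (x y : 'I_n) : same_block P x y -> x < y ->
  exists2 m : 'I_n, x <= m < y & enhanced_edge P m y.
Proof.
move=> sxy xy; pose Q (m : 'I_n) := (m < y) && same_block P m y.
have Qx : Q x by rewrite /Q xy.
case: (@arg_maxnP _ x Q (fun m => m) Qx) => m /andP[my smy] mmax.
exists m; first by rewrite my andbT; apply: mmax.
apply/orP; left; apply/(std_edgeP _ _ hP); split=> // z /andP[mz zy].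
apply/negP => smz; have : Q z.
  by rewrite /Q zy /=; apply: same_block_trans smy; rewrite same_blockC.
by move/mmax => /=; rewrite leqNgt mz.
Qed.

Lemma ex_enhanced_edge_after (x y : 'I_n) : same_block P x y -> x < y ->
  exists m : 'I_n, enhanced_edge P x m.
Proof.
move=> sxy xy; pose Q (m : 'I_n) := (x < m) && same_block P x m.
have Qy : Q y by rewrite /Q xy.
case: (@arg_minnP _ y Q (fun m => m) Qy) => m /andP[xm sxm] mmin.
exists m; apply/orP; left; apply/(std_edgeP _ _ hP); split=> // z /andP[xz zm].
apply/negP => sxz; have /mmin /= : Q z by rewrite /Q xz.
by rewrite leqNgt zm.
Qed.

Lemma enhanced_edge_cover (x : 'I_n) :
  [exists y, enhanced_edge P x y] || [exists y, enhanced_edge P y x].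
Proof.
case: (boolP [forall y, same_block P x y ==> (y == x)]) => [/forall_inP h|].
  apply/orP; left; apply/existsP; exists x; rewrite /enhanced_edge eqxx /=.
  by apply/orP; right; apply/(loopP _ hP) => j /h /eqP.
rewrite negb_forall => /existsP[y]; rewrite negb_imply => /andP[sxy yx].
apply/orP; case: (ltngtP x y) => xy; last by rewrite (val_inj xy) eqxx in yx.
  by left; apply/existsP; apply: ex_enhanced_edge_after sxy xy.
right; apply/existsP; rewrite same_blockC in sxy.
by have [m _] := ex_enhanced_edge_before sxy xy; exists m.
Qed.

End OnePartition.

Definition word_of P : seq letter :=
  [seq ([exists y, enhanced_edge P x y],
        omap (@nat_of_ord n) [pick y | enhanced_edge P y x]) | x <- enum 'I_n].

Lemma size_word_of P : size (word_of P) = n.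
Proof. by rewrite size_map size_enum_ord. Qed.

Lemma nth_word_of P (x : 'I_n) : nth (false, None) (word_of P) x =
  ([exists y, enhanced_edge P x y],
   omap (@nat_of_ord n) [pick y | enhanced_edge P y x]).
Proof. by rewrite (nth_map x) ?size_enum_ord // nth_ord_enum. Qed.

Lemma edge_word_of P (x y : 'I_n) : finset.partition P [set: 'I_n] ->
  edge (word_of P) x y = enhanced_edge P x y.
Proof.
move=> hP; rewrite /edge /source nth_word_of /=; case: pickP => [z ez|->] //=.
apply/eqP/idP => [[/val_inj <-] //|e]; congr Some.
by rewrite (enhanced_edge_source hP ez e).
Qed.

Lemma edge_word_ofP P (i j : nat) : finset.partition P [set: 'I_n] ->
  reflect (exists x y : 'I_n, [/\ i = x :> nat, j = y :> nat & enhanced_edge P x y])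
          (edge (word_of P) i j).
Proof.
move=> hP; apply: (iffP idP) => [e|[x [y [-> -> e]]]]; last by rewrite edge_word_of.
have jn := edge_size e; rewrite size_word_of in jn.
have [y jy] : exists y : 'I_n, j = y :> nat by exists (Ordinal jn).
move: e; rewrite jy /edge /source nth_word_of /=; case: pickP => [z ez|] //= /eqP[<-].
by exists z, y.
Qed.

Lemma opens_word_ofP P (i : nat) :
  reflect (exists x y : 'I_n, i = x :> nat /\ enhanced_edge P x y) (opens (word_of P) i).
Proof.
apply: (iffP idP) => [op|[x [y [-> e]]]]; last first.
  by rewrite /opens nth_word_of /=; apply/existsP; exists y.
have iN := opens_size op; rewrite size_word_of in iN.
have [x ix] : exists x : 'I_n, i = x :> nat by exists (Ordinal iN).
move: op; rewrite ix /opens nth_word_of /= => /existsP[y e]; by exists x, y.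
Qed.

Lemma crossingP P : finset.partition P [set: 'I_n] ->
  reflect (no3crossing (edge (word_of P))) (~~ has_enhanced_crossing 3 P).
Proof.
move=> hP; apply: (iffP idP) => [nc i1 i2 i3 j1 j2 j3 i123 ij j123|h].
  case=> /(edge_word_ofP _ _ hP)[x1 [y1 [? ? e1]]].
  move=> /(edge_word_ofP _ _ hP)[x2 [y2 [? ? e2]]].
  move=> /(edge_word_ofP _ _ hP)[x3 [y3 [? ? e3]]]; subst.
  move/negP: nc; apply; apply/existsP; exists [ffun a : 'I_3 => nth x1 [:: x1; x2; x3] a].
  apply/existsP; exists [ffun a : 'I_3 => nth y1 [:: y1; y2; y3] a].
  apply/and3P; split.
  - by apply/forallP => -[[|[|[|a]]] ha] //; rewrite !ffunE.
  - apply/forallP => -[[|[|[|a]]] ha] //; apply/forallP => -[[|[|[|b]]] hb] //;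
    rewrite !ffunE /=; lia.
  - apply/forallP => -[[|[|[|a]]] ha] //; apply/forallP => -[[|[|[|b]]] hb] //.
    by rewrite !ffunE.
apply/negP => /existsP[i /existsP[j /and3P[/forallP e /forallP m /forallP l]]].
pose a0 : 'I_3 := Ordinal (isT : 0 < 3); pose a1 : 'I_3 := Ordinal (isT : 1 < 3).
pose a2 : 'I_3 := Ordinal (isT : 2 < 3).
have /implyP/(_ isT)/andP[i01 j01] := forallP (m a0) a1.
have /implyP/(_ isT)/andP[i12 j12] := forallP (m a1) a2.
have /implyP/(_ isT) l20 := forallP (l a2) a0.
apply: (h (i a0) (i a1) (i a2) (j a0) (j a1) (j a2)) => //; rewrite ?i01 ?j01 //.
by split; rewrite edge_word_of.
Qed.

Lemma valid_word_of P : finset.partition P [set: 'I_n] ->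
  ~~ has_enhanced_crossing 3 P -> valid (word_of P).
Proof.
move=> hP /(crossingP hP) nc; split=> //.
- move=> i j /(edge_word_ofP _ _ hP)[x [y [-> -> e]]].
  rewrite (enhanced_edge_leq hP e) /=; apply/opens_word_ofP; by exists x, y.
- move=> i j j' /(edge_word_ofP _ _ hP)[x [y [-> -> e]]].
  move=> /(edge_word_ofP _ _ hP)[x' [y' [/val_inj <- -> e']]].
  by rewrite (enhanced_edge_target hP e e').
- move=> i /opens_word_ofP[x [y [-> e]]]; exists y; by rewrite edge_word_of.
- move=> j; rewrite size_word_of => jn.
  have [x ->] : exists x : 'I_n, j = x :> nat by exists (Ordinal jn).
  rewrite /opens /source nth_word_of /=; have := enhanced_edge_cover hP x.
  case/orP => [->|/existsP[y e]] //.
  by case: pickP => [z _|/(_ y)]; rewrite ?orbT ?e.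
Qed.

Definition partition_of w : {set {set 'I_n}} :=
  preim_partition (fun x : 'I_n => block_root w x) [set: 'I_n].

Lemma partition_ofP w : finset.partition (partition_of w) [set: 'I_n].
Proof. exact: preim_partitionP. Qed.

Lemma same_block_partition_of w x y :
  same_block (partition_of w) x y = (block_root w x == block_root w y).
Proof.
rewrite -mem_pblock_same ?partition_ofP //.
rewrite /partition_of /preim_partition pblock_equivalence_partition ?in_setT //.
by split=> // /eqP ->.
Qed.

(** A [prev] step stays in its block, so equal roots give equal blocks. Conversely, the larger of
    two points of a block has an entering edge whose source is not below the other point, and
    descending along this edge preserves the root. *)
Lemma same_block_word_of P x y : finset.partition P [set: 'I_n] ->
  valid (word_of P) -> same_block P x y = (block_root (word_of P) x == block_root (word_of P) y).
Proof.
move=> hP vP; set w := word_of P; have sw : size w = n := size_word_of P.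
have sroot (z : 'I_n) : exists2 t : 'I_n, block_root w z = t & same_block P z t.
  rewrite /block_root; elim: (size w) => [|k [t kt zt]]; first by exists z => //; apply: eqxx.
  rewrite iterS kt; have [pt|pt] := eqVneq (prev w t) t; first by exists t.
  have := edge_prev vP pt; case/(edge_word_ofP _ _ hP) => a [b [ta /val_inj tb e]]; subst b.
  exists a; rewrite ?ta //; apply: same_block_trans zt _; rewrite same_blockC.
  exact: enhanced_edge_same e.
have le k (a b : 'I_n) : b <= k -> a <= b -> same_block P a b -> block_root w a = block_root w b.
  elim: k a b => [|k IH] a b bk ab sab.
    by have -> : a = b by apply: val_inj; rewrite /=; lia.
  have [ba|ab'] := leqP b a; first by have -> : a = b by apply: val_inj; rewrite /=; lia.
  have [m /andP[am mb] e] := ex_enhanced_edge_before hP sab ab'.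
  have pm : prev w b = m by apply: prev_edge => //; rewrite edge_word_of.
  rewrite -(root_prev (x := b)) ?sw // pm; apply: IH => //; first lia.
  by apply: same_block_trans sab _; rewrite same_blockC; apply: enhanced_edge_same e.
apply/idP/eqP => [sxy|rxy].
  by case: (leqP x y) => xy; [|symmetry]; apply: le (leqnn _) _ _;
     rewrite ?(ltnW xy) // same_blockC.
have [a xa sxa] := sroot x; have [b yb syb] := sroot y.
have ab : a = b by apply: val_inj; rewrite /= -xa -yb.
by apply: same_block_trans sxa _; rewrite ab same_blockC.
Qed.

Lemma partition_ext P Q : finset.partition P [set: 'I_n] ->
  finset.partition Q [set: 'I_n] -> same_block P =2 same_block Q -> P = Q.
Proof.
move=> hP hQ PQ; have /and3P[/eqP cP tP zP] := hP; have /and3P[/eqP cQ tQ zQ] := hQ.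
have pE x : pblock P x = pblock Q x.
  by apply/setP => y; rewrite !mem_pblock_same.
apply/setP => B; apply/idP/idP => hB.
  have [x xB] : exists x, x \in B by apply/set0Pn; apply: contraNneq zP => <-.
  by rewrite -(def_pblock tP hB xB) pE pblock_mem // cQ in_setT.
have [x xB] : exists x, x \in B by apply/set0Pn; apply: contraNneq zQ => <-.
by rewrite -(def_pblock tQ hB xB) -pE pblock_mem // cP in_setT.
Qed.

Lemma word_ofK P : finset.partition P [set: 'I_n] -> ~~ has_enhanced_crossing 3 P ->
  partition_of (word_of P) = P.
Proof.
move=> hP nc; apply: partition_ext => // [|x y]; first exact: partition_ofP.
by rewrite same_block_partition_of same_block_word_of //; apply: valid_word_of.
Qed.

Lemma enhanced_edge_partition_of w (x y : 'I_n) : size w = n -> valid w ->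
  enhanced_edge (partition_of w) x y = edge w x y.
Proof.
move=> sw vw; have hP := partition_ofP w; have [v1 v2 v3 v4 _] := vw.
have iter_neq (a b : nat) : a < b -> b < n -> block_root w a = block_root w b ->
    prev w b != b /\ exists k, iter k (prev w) (prev w b) = a.
  move=> ab bn /(root_eq vw (ltnW ab)); rewrite sw => /(_ bn)[k kb].
  have pb : prev w b != b.
    apply/eqP => pb; move: kb; have -> : iter k (prev w) b = b by elim: k => //= k ->.
    by move=> ba; rewrite ba ltnn in ab.
  split=> //; case: k kb => [/= ba|k]; first by rewrite ba ltnn in ab.
  by rewrite iterSr; exists k.
have ordP k : k <= y -> k < n by move=> h; apply: leq_ltn_trans h (ltn_ord y).
apply/orP/idP => [[/(std_edgeP _ _ hP)[xy]|/andP[/eqP <- /(loopP _ hP)]]|e].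
- rewrite same_block_partition_of => /eqP rxy h.
  have [py [k kx]] := iter_neq _ _ xy (ltn_ord y) rxy.
  suff -> : nat_of_ord x = prev w y by apply: edge_prev.
  have xp : x <= prev w y by rewrite -kx iter_prev_leq.
  have pyy : prev w y < y by rewrite ltn_neqAle py prev_leq.
  apply/eqP; rewrite eqn_leq xp /= leqNgt; apply/negP => xp'.
  have := h (Ordinal (ordP _ (prev_leq w y))); rewrite /= xp' pyy => /(_ isT).
  by rewrite same_block_partition_of /= root_prev ?sw // rxy eqxx.
(* Singleton block: the fourth clause of [valid] provides an edge at [x]; its other end has the same
   root, hence is [x] itself. *)
- move=> h; have h' (j : 'I_n) : block_root w x = block_root w j -> j = x.
    by move=> r; apply: h; rewrite same_block_partition_of r eqxx.
  have e_same i j : edge w i j -> block_root w i = block_root w j.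
    by move=> e; rewrite -(prev_edge vw e) root_prev // (edge_size e).
  have : opens w x || source w x by apply: v4; rewrite sw.
  case/orP => [/v3[j e]|].
    have jn : j < n by rewrite -sw (edge_size e).
    have := h' (Ordinal jn) (e_same _ _ e) => /(congr1 (@nat_of_ord n)) /= jx.
    by rewrite -{2}jx.
  case E : (source w x) => [i|] // _; have e : edge w i x by apply/eqP.
  have /andP[ix _] := v1 _ _ e; have iN : i < n := leq_ltn_trans ix (ltn_ord x).
  have := h' (Ordinal iN) (esym (e_same _ _ e)) => /(congr1 (@nat_of_ord n)) /= xi.
  by rewrite -{1}xi.
have py := prev_edge vw e; have /andP[] := v1 _ _ e; rewrite leq_eqVlt => /orP[/eqP xy|xy] _.
  right; have {}xy := val_inj xy; subst y; rewrite eqxx /=.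
  apply/(loopP _ hP) => j; rewrite same_block_partition_of => /eqP r.
  apply: val_inj; case: (ltngtP j x) => //= jx.
    by case: (iter_neq _ _ jx (ltn_ord x) (esym r)); rewrite py eqxx.
  (* A larger point of the block would descend to [x] along [prev]; the last proper step would be a
     second edge leaving [x], next to the loop [e]. *)
  have jw : j < size w by rewrite sw.
  have [k] := root_eq vw (ltnW jx) jw r.
  elim: k => [/= kx|k IH]; first by move: jx; rewrite kx ltnn.
  rewrite iterS; set z := iter k _ _ => kx.
  have [pz|pz] := eqVneq (prev w z) z; first by apply: IH; rewrite -/z -pz.
  have := edge_prev vw pz; rewrite kx => ez.
  have zx := v2 _ _ _ ez e; by rewrite zx py eqxx in pz.
left; apply/(std_edgeP _ _ hP); split=> //.
  by rewrite same_block_partition_of -py root_prev ?sw.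
move=> m /andP[xm my]; rewrite same_block_partition_of; apply/negP => /eqP r.
have r' : block_root w m = block_root w y by rewrite -r -py root_prev ?sw.
have [_ [k kx]] := iter_neq _ _ my (ltn_ord y) r'.
by move: xm; rewrite -kx py ltnNge iter_prev_leq.
Qed.

Lemma partition_ofK w : size w = n -> valid w -> word_of (partition_of w) = w.
Proof.
move=> sw vw; have hP := partition_ofP w; have E := enhanced_edge_partition_of _ _ sw vw.
have [v1 _ v3 _ _] := vw.
apply: (@eq_from_nth _ (false, None)); rewrite size_word_of ?sw // => i iN.
have [x ix] : exists x : 'I_n, i = x :> nat by exists (Ordinal iN).
rewrite {iN}ix nth_word_of.
rewrite [RHS]surjective_pairing -/(opens w _) -/(source w _); congr pair.
  apply/existsP/idP => [[y]|/v3[j e]].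
    by rewrite E => /v1 /andP[].
  have jn : j < n by rewrite -sw (edge_size e).
  by exists (Ordinal jn); rewrite E.
case: pickP => [y|h] /=; first by rewrite E => /eqP.
case S : (source w x) => [j|] //; have e : edge w j x by apply/eqP.
have /andP[ji _] := v1 _ _ e.
by have := h (Ordinal (leq_ltn_trans ji (ltn_ord x))); rewrite E e.
Qed.

End PartitionWord.

Lemma E3_completions n : E3 n = completions n [::].
Proof.
have wf0 : wf [::] by [].
rewrite -[RHS](size_words n wf0).
rewrite /E3 cardE -(size_map (@word_of n)); apply: perm_size; apply: uniq_perm.
- rewrite map_inj_in_uniq ?enum_uniq // => P Q.
  rewrite !mem_enum !inE => /andP[hP cP] /andP[hQ cQ] PQ.
  by rewrite -(word_ofK hP cP) PQ word_ofK.
- exact: uniq_words.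
move=> w; rewrite mem_words; apply/mapP/andP => [[P]|[/eqP sw /accepts_valid vw]].
  rewrite mem_enum inE => /andP[hP cP] ->; rewrite size_word_of; split=> //.
  by apply/accepts_valid/valid_word_of.
exists (partition_of n w); last by rewrite partition_ofK.
rewrite mem_enum inE partition_ofP /=; apply/(crossingP (partition_ofP n w)).
by rewrite partition_ofK //; case: vw.
Qed.

End NoncrossingWords.

Local Open Scope ring_scope.

(** * Free walk counts and their signed sum over the reflection group *)

Section ChamberWalks.
Implicit Types b : seq bool.

(* [step_count m a b] is the coefficient of x^a y^b in
   ((1 + x) (1 + y) (x + y) / (x y)) ^ m. *)
Fixpoint step_count m (a b : int) : int :=
  if m is m'.+1 then
    step_count m' a b * 2 + step_count m' (a + 1) b + step_count m' (a - 1) b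
    + step_count m' a (b + 1) + step_count m' a (b - 1)
    + step_count m' (a + 1) (b - 1) + step_count m' (a - 1) (b + 1)
  else ((a == 0) && (b == 0))%:R.

Lemma step_count_swap m (a b : int) : step_count m a b = step_count m b a.
Proof.
elim: m a b => [|m IH] a b /=; first by rewrite andbC.
rewrite (IH a b) (IH (a + 1) b) (IH (a - 1) b) (IH a (b + 1)) (IH a (b - 1)).
rewrite (IH (a + 1) (b - 1)) (IH (a - 1) (b + 1)); ring.
Qed.

Lemma step_count_shear m (a b : int) : step_count m a b = step_count m (a + b) (- b).
Proof.
elim: m a b => [|m IH] a b /=; first by congr (_%:R); lia.
have e u v u' v' : u + v = u' -> - v = v' -> step_count m u v = step_count m u' v'.
  by move=> <- <-; exact: IH.
rewrite (e a b (a + b) (- b)) // (e (a + 1) b (a + b + 1) (- b)) //; last ring.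
rewrite (e (a - 1) b (a + b - 1) (- b)) //; last ring.
rewrite (e a (b + 1) (a + b + 1) (- b - 1)); [|ring..].
rewrite (e a (b - 1) (a + b - 1) (- b + 1)); [|ring..].
rewrite (e (a + 1) (b - 1) (a + b) (- b + 1)); [|ring..].
rewrite (e (a - 1) (b + 1) (a + b) (- b - 1)); [|ring..].
ring.
Qed.

(** Minus the identity is the cube of the composite of the shear and the swap. *)
Lemma step_count_opp m (a b : int) : step_count m a b = step_count m (- a) (- b).
Proof.
rewrite (step_count_shear m a b) step_count_swap step_count_shear step_count_swap.
rewrite step_count_shear step_count_swap.
by congr step_count; ring.
Qed.

(* The signed orbit of (2, 1) under the dihedral group of order 12 generated by
   (i, j) |-> (j, i) and (i, j) |-> (i + j, - j), translated by - (2, 1). *)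
Definition orbit : seq (int * (int * int)) :=
  [:: (1, (0, 0)); (-1, (-1, 1)); (-1, (1, -2)); (1, (-3, 2)); (1, (1, -3));
      (-1, (-4, 2)); (-1, (-3, -3)); (1, (-4, -2)); (1, (-1, -4)); (-1, (0, -4));
      (1, (-5, 1)); (-1, (-5, 0))].

Definition chamber_count m (i j : int) : int :=
  \sum_(g <- orbit) g.1 * step_count m (i - g.2.1) (j - g.2.2).

Lemma chamber_count0 (i j : int) : 0 <= j -> 0 < i + j -> chamber_count 0 i j = 0.
Proof.
move=> j0 ij; rewrite /chamber_count big_seq big1 // => g gO.
have : (g.2.1 + g.2.2 <= 0) || (g.2.2 < 0) by move: g gO; apply/allP.
case: g {gO} => e [g1 g2] /= h; case: andP => [[/eqP h1 /eqP h2]|_]; last exact: mulr0.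
by exfalso; lia.
Qed.

Lemma chamber_count00 : chamber_count 0 0 0 = 1.
Proof. by rewrite /chamber_count /orbit !big_cons big_nil. Qed.

Lemma chamber_countS m (i j : int) : chamber_count m.+1 i j =
  chamber_count m i j * 2 + chamber_count m (i + 1) j + chamber_count m (i - 1) j
  + chamber_count m i (j + 1) + chamber_count m i (j - 1)
  + chamber_count m (i + 1) (j - 1) + chamber_count m (i - 1) (j + 1).
Proof.
rewrite /chamber_count mulr_suml -!big_split /=; apply: eq_bigr => g _.
have e u v u' v' : u = u' -> v = v' -> step_count m u v = step_count m u' v'.
  by move=> -> ->.
rewrite (e (i - g.2.1 + 1) _ (i + 1 - g.2.1) (j - g.2.2)) //; last ring.
rewrite (e (i - g.2.1 - 1) _ (i - 1 - g.2.1) (j - g.2.2)) //; last ring.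
rewrite (e _ (j - g.2.2 + 1) (i - g.2.1) (j + 1 - g.2.2)) //; last ring.
rewrite (e _ (j - g.2.2 - 1) (i - g.2.1) (j - 1 - g.2.2)) //; last ring.
rewrite (e (i - g.2.1 + 1) _ (i + 1 - g.2.1) (j - 1 - g.2.2)); [|ring..].
rewrite (e (i - g.2.1 - 1) _ (i - 1 - g.2.1) (j + 1 - g.2.2)); [|ring..].
ring.
Qed.

(** The swap permutes [orbit] and flips all its signs, which is checked by evaluation. The shifts by
    1 come from the translation by (2, 1). *)
Lemma chamber_count_swap m (i j : int) : chamber_count m i j = - chamber_count m (j - 1) (i + 1).
Proof.
rewrite /chamber_count -sumrN.
rewrite (perm_big [seq (- g.1, (g.2.2 - 1, g.2.1 + 1)) | g <- orbit]) //.
rewrite big_map; apply: eq_bigr => g _ /=; rewrite step_count_swap mulNr.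
by congr (- (_ * step_count _ _ _)); ring.
Qed.

Lemma chamber_count_shear m (i j : int) :
  chamber_count m i j = - chamber_count m (i + j + 1) (- 2 - j).
Proof.
rewrite /chamber_count -sumrN.
rewrite (perm_big [seq (- g.1, (g.2.1 + g.2.2 + 1, - 2 - g.2.2)) | g <- orbit]) //.
rewrite big_map; apply: eq_bigr => g _ /=; rewrite step_count_shear mulNr.
by congr (- (_ * step_count _ _ _)); ring.
Qed.

Lemma chamber_count_wall m (i : int) : chamber_count m i (- 1) = 0.
Proof.
have := chamber_count_shear m i (- 1); rewrite subrK.
have -> : - 2 - - 1 = - 1 :> int by [].
by set x := chamber_count _ _ _ => ?; lia.
Qed.

Definition binz m (x : int) : int := if x is Posz k then 'C(m, k)%:Z else 0.

Lemma binzS m (x : int) : binz m.+1 x = binz m x + binz m (x - 1).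
Proof.
case: x => [[|k]|k] //; first by rewrite /= !bin0.
rewrite (_ : Posz k.+1 - 1 = Posz k); last by lia.
by rewrite /= binS PoszD.
Qed.

Lemma sum_binS m (g : nat -> int) : \sum_(k < m.+2) 'C(m.+1, k)%:Z * g k =
  \sum_(k < m.+1) 'C(m, k)%:Z * g k + \sum_(k < m.+1) 'C(m, k)%:Z * g k.+1.
Proof.
rewrite big_ord_recl; under eq_bigr => k _ do rewrite lift0 binS PoszD mulrDl.
rewrite big_split /= addrA; congr (_ + _).
by rewrite big_ord_recr /= (bin_small (ltnSn m)) mul0r addr0 [RHS]big_ord_recl !bin0.
Qed.

(** The index [k] is the power of x chosen in (x + y)^m; the two other binomials are then the
    required coefficients of (1 + x)^m and (1 + y)^m. *)
Lemma step_countE m (a b : int) : step_count m a b =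
  \sum_(k < m.+1) 'C(m, k)%:Z * (binz m (k%:Z - a) * binz m (k%:Z + b)).
Proof.
elim: m a b => [|m IH] a b.
  rewrite big_ord1 bin0 mul1r !add0r /=.
  have E x : binz 0 x = (x == 0)%:R by case: x => [[|k]|k].
  by rewrite !E oppr_eq0; case: (a == 0); case: (b == 0).
rewrite (sum_binS m (fun k => binz m.+1 (k%:Z - a) * binz m.+1 (k%:Z + b))).
rewrite /= !IH mulr_suml -!big_split /=; apply: eq_bigr => k _.
rewrite !binzS -(addn1 k) PoszD.
have e u v : u = v -> binz m u = binz m v by move=> ->.
rewrite (e (k%:Z + 1 - a - 1) (k%:Z - a)) ?(e (k%:Z + 1 + b - 1) (k%:Z + b)); [|ring..].
rewrite (e (k%:Z - (a + 1)) (k%:Z - a - 1)) ?(e (k%:Z - (a - 1)) (k%:Z + 1 - a)); [|ring..].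
rewrite (e (k%:Z + (b + 1)) (k%:Z + 1 + b)) ?(e (k%:Z + (b - 1)) (k%:Z + b - 1)); [|ring..].
ring.
Qed.

(** * Polynomial weights of patterns, and the identity that linearizes the transfer *)

Definition gsum k : {poly int} := \sum_(i < k) 'X^i.

Lemma gsumS k : gsum k.+1 = 1 + 'X * gsum k.
Proof.
rewrite /gsum big_ord_recl mulr_sumr; congr (_ + _).
by apply: eq_bigr => i _; rewrite lift0 exprS.
Qed.

Lemma gsum0 : gsum 0 = 0. Proof. exact: big_ord0. Qed.

Lemma gsum1 : gsum 1 = 1. Proof. by rewrite gsumS gsum0 mulr0 addr0. Qed.

(** An identity of q-integers, [gsum k] being (1 - X^k) / (1 - X). In [sum_weight_close] the product
    on the right cancels the defect left by the rest of the pattern, and the last term is the new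
    defect. *)
Lemma gsum_mul (a b : nat) : 'X * gsum a * gsum b.+1 = gsum a.+1 * gsum b.+2 - gsum (a + b).+2.
Proof.
elim: a => [|a IH]; first by rewrite gsum0 gsum1 mulr0 !mul0r mul1r subrr.
rewrite addSn (gsumS (a + b).+2) (gsumS a.+1) (_ : gsum (a + b).+2 =
  gsum a.+1 * gsum b.+2 - 'X * gsum a * gsum b.+1); last by rewrite IH opprB addrC subrK.
rewrite (gsumS a) (gsumS b.+1); move: (gsum a) (gsum b.+1) => A B; ring.
Qed.

(* A maximal run of [k] unmarked arcs followed by a marked one contributes the
   factor 1 + X + ... + X^(k+1); [r] is the length of a run in progress. *)
Fixpoint weight r b : {poly int} :=
  if b is x :: b' then
    if x then gsum r.+2 * weight 0 b' else weight r.+1 b'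
  else 1.

Lemma weight_tail r n : weight r (rcons (nseq n false) true) = gsum (r + n).+2.
Proof. by elim: n r => [|n IH] r /=; rewrite ?mulr1 ?addn0 // IH addSnnS. Qed.

Lemma weight_tail_marks n : weight 0 (tail_marks n) = gsum n.+1.
Proof. by case: n => [|n] /=; rewrite ?gsum1 // weight_tail. Qed.

Lemma weight_rcons r b : last (r == 0%N) b ->
  weight r (rcons b true) = (1 + 'X) * weight r b.
Proof.
elim: b r => [|x b IH] r /=; first by move=> /eqP ->; rewrite !gsumS gsum0 mulr0; ring.
by case: x => lb; rewrite IH // mulrCA.
Qed.

Lemma size_close b q : (q < size b)%N -> size (close b q) = (size b).-1.
Proof.
have size_tail n : size (tail_marks n) = n by case: n => //= n; rewrite size_rcons size_nseq.
elim: b q => // x b IH [|q] /= qb; first exact: size_tail.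
by rewrite IH //; case: (size b) qb.
Qed.

Lemma last_close b q z : (q < size b)%N -> last false b -> last (z || (q == 0%N)) (close b q).
Proof.
elim: b q z => // x b IH [|q] z /= qb lb.
  by rewrite orbT; case: (size b) => //= n; rewrite last_rcons.
by apply: IH => //; case: b lb qb.
Qed.

(** A run of [r] unmarked arcs precedes [b]. Closing the first arc of [b] makes the last arc of this
    run closable, so the run ends one arc earlier; this is the separate value at [q = 0]. An empty
    run contributes [gsum 1], which is 1. *)
Lemma sum_weight_close r b : last (r == 0%N) b ->
  'X * \sum_(q < size b | nth false b q)
         (if q == 0%N :> nat then gsum r.+1 * gsum (size b) else weight r (close b q))
  = (1 + 'X) * weight r b - gsum (r + size b).+2.
Proof.
elim: b r => [|x b IH] r /=.
  by move=> /eqP ->; rewrite big_ord0 !gsumS gsum0 !mulr0; ring.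
move=> lb; rewrite big_mkcond big_ord_recl /= -big_mkcond /=.
case: x lb => /= lb.
  have := IH 0%N lb; rewrite add0n => {}IH.
  have -> : \sum_(q < size b | nth false b q)
      gsum r.+2 * weight 0 (close b q) = gsum r.+2 * \sum_(q < size b | nth false b q)
     (if q == 0%N :> nat then gsum 1 * gsum (size b) else weight 0 (close b q)).
    rewrite mulr_sumr; apply: eq_bigr => -[[|q] qb] _ //=; case: b qb {lb IH} => //= y b _.
    by rewrite weight_tail_marks gsum1 mul1r.
  rewrite mulrDr mulrA (gsum_mul r.+1) [X in _ + X]mulrCA IH addnS; ring.
rewrite add0r.
have -> : \sum_(q < size b | nth false b q)
     (if q == 0%N :> nat then gsum r.+2 * weight 0 (close b q) else weight r.+1 (close b q))
  = \sum_(q < size b | nth false b q)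
     (if q == 0%N :> nat then gsum r.+2 * gsum (size b) else weight r.+1 (close b q)).
  apply: eq_bigr => -[[|q] qb] _ //=; case: b qb {lb IH} => //= y b _.
  by rewrite weight_tail_marks.
by rewrite IH // addnS addSn.
Qed.

Lemma sum_weight_close0 b : last true b ->
  'X * \sum_(q < size b | nth false b q) weight 0 (close b q)
  = (1 + 'X) * weight 0 b - gsum (size b).+2.
Proof.
move=> lb; rewrite -[(size b).+2]/(0 + size b).+2 -sum_weight_close //.
congr (_ * _); apply: eq_bigr => -[[|q] qb] _ //=; case: b qb {lb} => //= y b _.
by rewrite weight_tail_marks gsum1 mul1r.
Qed.

Definition coef_pair (g : nat -> int) (p : {poly int}) := \sum_(j < size p) p`_j * g j.

Lemma coef_pair_wide N g (p : {poly int}) : (size p <= N)%N ->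
  coef_pair g p = \sum_(j < N) p`_j * g j.
Proof.
move=> pN; rewrite /coef_pair (big_ord_widen N (fun j => p`_j * g j)) // big_mkcond /=.
by apply: eq_bigr => j _; case: ltnP => // /(nth_default 0) ->; rewrite mul0r.
Qed.

Lemma coef_pairD g p q : coef_pair g (p + q) = coef_pair g p + coef_pair g q.
Proof.
pose N := (maxn (size p) (size q)).
rewrite !(@coef_pair_wide N) ?leq_maxl ?leq_maxr ?size_polyD //.
by rewrite -big_split; apply: eq_bigr => j _; rewrite coefD mulrDl.
Qed.

Lemma coef_pair0 g : coef_pair g 0 = 0.
Proof. by rewrite /coef_pair size_poly0 big_ord0. Qed.

Lemma coef_pair_sum g I (r : seq I) (P : pred I) F :
  coef_pair g (\sum_(i <- r | P i) F i) = \sum_(i <- r | P i) coef_pair g (F i).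
Proof. exact: (big_morph _ (coef_pairD g) (coef_pair0 g)). Qed.

Lemma coef_pairX g p : coef_pair g ('X * p) = coef_pair (fun j => g j.+1) p.
Proof.
rewrite (@coef_pair_wide (size p).+1) ?(leq_trans (size_polyMleq _ _)) ?size_polyX //.
rewrite big_ord_recl coefXM mul0r add0r; apply: eq_bigr => j _.
by rewrite lift0 coefXM.
Qed.

Lemma coef_pair1X g p :
  coef_pair g ((1 + 'X) * p) = coef_pair (fun j => g j + g j.+1) p.
Proof.
rewrite mulrDl mul1r coef_pairD coef_pairX -big_split.
by apply: eq_bigr => j _; rewrite mulrDr.
Qed.

Lemma coef_pair_gsum g k : coef_pair g (gsum k) = \sum_(j < k) g j.
Proof.
elim: k g => [|k IH] g; first by rewrite gsum0 coef_pair0 big_ord0.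
rewrite gsumS coef_pairD coef_pairX IH big_ord_recl; congr (_ + _).
by rewrite /coef_pair size_poly1 big_ord1 coef1 mul1r.
Qed.

(** The term [j = 0] lies on the wall at -1, and the swap reflection reverses the order of the
    others while changing their sign. The sum is the pairing with [gsum N.+2], the defect in
    [sum_weight_close0]. *)
Lemma sum_chamber_count m N :
  \sum_(j < N.+2) chamber_count m (N%:Z - j%:Z) (j%:Z - 1) = 0.
Proof.
rewrite big_ord_recl /= sub0r chamber_count_wall add0r.
set S := (X in X = 0); suff : S = - S by lia.
rewrite {1}/S (reindex_inj rev_ord_inj) -sumrN /=; apply: eq_bigr => j _.
rewrite chamber_count_swap; congr (- chamber_count _ _ _);
  by rewrite /= /bump /=; have := ltn_ord j; lia.
Qed.

(* Multiplying the weight by 1 + X turns the sum over the arcs to close into the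
   six steps of the walk, and the missing initial segment of the weights is
   cancelled by the antisymmetry of [chamber_count]. *)
Lemma completionsE m b : last true b -> (completions m b)%:Z =
  coef_pair (fun j => chamber_count m ((size b)%:Z - j%:Z) j%:Z) (weight 0 b).
Proof.
elim: m b => [|m IH] b lb.
  case: b lb => [|x b] lb.
    by rewrite /coef_pair /= size_poly1 big_ord1 coef1 chamber_count00.
  by rewrite /coef_pair big1 // => j _; rewrite chamber_count0 ?mulr0 //=; lia.
have closeE b' : last true b' ->
    (\sum_(q < size b' | nth false b' q) completions m (close b' q))%N%:Z
    = coef_pair (fun j => chamber_count m ((size b')%:Z - j%:Z) (j%:Z - 1))
        ((1 + 'X) * weight 0 b').
  move=> lb'; pose g (j : nat) := chamber_count m ((size b')%:Z - j%:Z) (j%:Z - 1).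
  have -> : (1 + 'X) * weight 0 b' = gsum (size b').+2
      + 'X * \sum_(q < size b' | nth false b' q) weight 0 (close b' q).
    by rewrite sum_weight_close0 // [RHS]addrC subrK.
  rewrite coef_pairD coef_pair_gsum sum_chamber_count add0r coef_pairX coef_pair_sum.
  rewrite -natz natr_sum; apply: eq_bigr => q _; rewrite natz IH; last first.
    case: b' lb' {g} q => [|x b'] lb' q; first by case: q.
    exact: (last_close true (ltn_ord q)).
  rewrite size_close //; apply: eq_bigr => j _.
  by congr (_ * chamber_count _ _ _); have := ltn_ord q; lia.
rewrite [completions _ _]/= !PoszD !closeE ?last_rcons // IH ?last_rcons //.
rewrite weight_rcons // !coef_pair1X -!big_split size_rcons; apply: eq_bigr => j _ /=.
rewrite -!mulrDr; congr (_ * _); rewrite chamber_countS.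
move: (chamber_count m) => G {IH closeE}.
have e u v u' v' : u = u' -> v = v' -> G u v = G u' v' by move=> -> ->.
rewrite !intS; move: (size b)%:Z (nat_of_ord j)%:Z => x y {j}.
rewrite (e (1 + x - y) y (x - y + 1) y) ?(e (1 + x - y) (y - 1) (x - y + 1) (y - 1)); [|ring..].
rewrite (e (1 + x - (1 + y)) (1 + y) (x - y) (y + 1)); [|ring..].
rewrite (e (x - (1 + y)) (1 + y - 1) (x - y - 1) y); [|ring..].
rewrite (e (1 + x - (1 + y)) (1 + y - 1) (x - y) y); [|ring..].
rewrite (e (1 + x - (1 + (1 + y))) (1 + (1 + y) - 1) (x - y - 1) (y + 1)); [|ring..].
ring.
Qed.

Lemma completions_nil n : (completions n [::])%:Z = chamber_count n 0 0.
Proof.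
rewrite completionsE // /coef_pair /= size_poly1 big_ord1 coef1 mul1r.
by rewrite subr0.
Qed.

End ChamberWalks.

(** * Zeilberger's algorithm: from the signed sum to Franel numbers *)

Definition falls (x : int) i := \prod_(l < i) (x - l%:Z).

(* Zeilberger's algorithm, with m = n + 3 and k centred at m + 3: the sum over k of
   the left-hand side of [enhanced_certificateP] times C(m + 3, k) ^ 3 telescopes
   to a combination of the moments of order 0 and 1 in k (m + 3 - k). *)
Definition enhanced_certificate (m k : int) : int :=
  let z := k * (m + 4 - k) in
  (2 * k - (m + 4)) *
  (7776 + 12168 * m - 8700 * m ^+ 2 - 8922 * m ^+ 3 - 6267 * m ^+ 4 - 7116 * m ^+ 5
   - 2274 * m ^+ 6 - 624 * m ^+ 7 - 39 * m ^+ 8 + 192 * m ^+ 9 - 18 * m ^+ 11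
   + (- 11664 - 10392 * m + 17532 * m ^+ 2 + 15234 * m ^+ 3 + 12316 * m ^+ 4
      + 7774 * m ^+ 5 + 376 * m ^+ 6 - 150 * m ^+ 7 + 96 * m ^+ 8 - 18 * m ^+ 9) * z
   + (6858 + 651 * m - 14334 * m ^+ 2 - 11380 * m ^+ 3 - 6522 * m ^+ 4 - 1637 * m ^+ 5
      + 174 * m ^+ 6 - 18 * m ^+ 7) * z ^+ 2
   + (- 1827 + 2388 * m + 6096 * m ^+ 2 + 3686 * m ^+ 3 + 1043 * m ^+ 4
      - 18 * m ^+ 5) * z ^+ 3
   + (108 - 1162 * m - 1330 * m ^+ 2 - 428 * m ^+ 3) * z ^+ 4
   + (58 + 228 * m + 116 * m ^+ 2) * z ^+ 5
   - (14 + 17 * m) * z ^+ 6 + z ^+ 7).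

(** The sum of [chamber_count_triple] added to its image under k -> m + 3 - k, which replaces every
    offset i by 6 - i. This symmetry lets the summand be reduced to moments in k (m + 3 - k). *)
Definition enhanced_terms : seq (int * (nat * nat * nat)) :=
  [:: (2, (3, 3, 3)%N); (- 2, (2, 3, 4)%N); (- 2, (1, 3, 5)%N); (- 2, (0, 3, 6)%N);
      (2, (2, 3, 5)%N); (2, (1, 3, 4)%N); (2, (1, 2, 6)%N); (2, (0, 4, 5)%N);
      (- 1, (2, 3, 3)%N); (- 1, (3, 3, 4)%N); (- 1, (1, 1, 6)%N); (- 1, (0, 5, 5)%N);
      (- 1, (1, 1, 5)%N); (- 1, (1, 5, 5)%N); (1, (0, 2, 6)%N); (1, (0, 4, 6)%N)].

Lemma enhanced_certificateP (m k : int) :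
  let p i := falls k i * falls (m + 3 - k) (6 - i) in
  \sum_(c <- enhanced_terms) c.1 * (p c.2.1.1 * p c.2.1.2 * p c.2.2)
  = 3 * (m - 2) ^+ 2 * (m - 1) ^+ 2 * m * (m + 1) * (m + 2) * (m + 3)
    * ((24 * m ^+ 5 + 152 * m ^+ 4 + 296 * m ^+ 3 + 115 * m ^+ 2 - 157 * m - 84)
         * (k * (m + 3 - k))
       - (m + 2) * (m + 3) ^+ 2 * (6 * m ^+ 4 + 24 * m ^+ 3 + 18 * m ^+ 2 - 13 * m - 9))
    + enhanced_certificate m (k + 1) * (m + 3 - k) ^+ 3
    - enhanced_certificate m k * k ^+ 3.
Proof.
move=> p; rewrite /enhanced_terms !big_cons big_nil /p /falls !big_ord_recr !big_ord0.
rewrite /enhanced_certificate /=.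
ring.
Qed.

Lemma binz_small n (x : int) : (x < 0) || (n%:Z < x) -> binz n x = 0.
Proof. by case: x => [k|k] //= h; rewrite bin_small //; lia. Qed.

Lemma binz_up n (x : int) : n.+1%:Z * binz n x = (n.+1%:Z - x) * binz n.+1 x.
Proof.
case: x => [k|k]; last by rewrite /= !mulr0.
have [kn|nk] := leqP k n; last first.
  rewrite /= bin_small // mulr0; have [->|] := eqVneq k n.+1; first by rewrite subrr mul0r.
  by move=> kn; rewrite bin_small ?mulr0 //; lia.
rewrite subzn ?(leqW kn) // -!PoszM; congr Posz.
by rewrite -(mul_bin_down n.+1).
Qed.

Lemma binz_upS n (x : int) : n.+1%:Z * binz n (x - 1) = x * binz n.+1 x.
Proof.
case: x => [[|k]|k]; first by rewrite mul0r mulr0.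
  rewrite (_ : Posz k.+1 - 1 = Posz k); last by lia.
  by rewrite /= -!PoszM (mul_bin_diag n.+1).
by rewrite /= !mulr0.
Qed.

Lemma falls0 x : falls x 0 = 1. Proof. exact: big_ord0. Qed.

Lemma fallsS x i : falls x i.+1 = x * falls (x - 1) i.
Proof.
rewrite /falls big_ord_recl subr0; congr (_ * _).
by apply: eq_bigr => l _; rewrite lift0 intS; ring.
Qed.

(** All shifted binomials become polynomial multiples of one binomial, so a triple product turns
    into a polynomial in k times the cube of C(n + s, k). *)
Lemma binz_falls n s i (x : int) : (i <= s)%N ->
  falls (n + s)%N%:Z s * binz n (x - i%:Z)
  = falls x i * falls ((n + s)%N%:Z - x) (s - i) * binz (n + s) x.
Proof.
elim: s i x => [|s IH] i x.
  by rewrite leqn0 => /eqP ->; rewrite subnn !falls0 !mul1r subr0 addn0.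
rewrite leq_eqVlt => /orP[/eqP ->|]; last rewrite ltnS => lis.
  rewrite subnn !fallsS !falls0 mulr1 addnS -mulrA intS.
  rewrite (_ : 1 + (n + s)%N%:Z - 1 = (n + s)%N%:Z); last by ring.
  rewrite (_ : x - (1 + s%:Z) = x - 1 - s%:Z); last by ring.
  rewrite IH // subnn falls0 mulr1 mulrCA -intS binz_upS; ring.
rewrite subSn // !fallsS addnS -mulrA.
rewrite (_ : (n + s).+1%:Z - 1 = (n + s)%N%:Z); last by rewrite intS; ring.
rewrite (_ : (n + s).+1%:Z - x - 1 = (n + s)%N%:Z - x); last by rewrite intS; ring.
rewrite IH // mulrCA binz_up; ring.
Qed.

Definition triple_sum n (i j l : nat) :=
  \sum_(k < (n + 6).+1) binz n (k%:Z - i%:Z) * binz n (k%:Z - j%:Z) * binz n (k%:Z - l%:Z).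

Lemma sum_window (V : nmodType) (F : nat -> V) n i p : (i + n <= p)%N ->
  (forall k, (k < i)%N || (i + n <= k)%N -> F k = 0) ->
  \sum_(k < p) F k = \sum_(k < n) F (k + i)%N.
Proof.
move=> le_p F0; rewrite -(big_mkord predT F) (@big_cat_nat _ _ _ i) //=; last first.
  exact: leq_trans (leq_addr n i) le_p.
rewrite (@big_cat_nat _ _ _ (i + n) i p) ?leq_addr //=.
rewrite big_nat_cond big1 ?add0r; last by move=> k /andP[/andP[_ ki] _]; rewrite F0 ?ki.
rewrite [X in _ + X]big_nat_cond [X in _ + X]big1 ?addr0.
  by rewrite -{1}(add0n i) big_addn addKn big_mkord.
by move=> k /andP[/andP[ki _] _]; rewrite F0 ?ki ?orbT.
Qed.

Lemma step_count_triple n (i j l : nat) : (i <= 6)%N ->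
  step_count n (j%:Z - i%:Z) (i%:Z - l%:Z) = triple_sum n i j l.
Proof.
move=> i6; rewrite step_countE /triple_sum.
rewrite (@sum_window _ (fun k => binz n (k%:Z - i%:Z) * binz n (k%:Z - j%:Z)
                                 * binz n (k%:Z - l%:Z)) n.+1 i); first last.
- by move=> k ki; rewrite binz_small ?mul0r //; lia.
- by lia.
apply: eq_bigr => k _; rewrite -mulrA PoszD addrK.
congr (_ * (binz _ _ * binz _ _)); ring.
Qed.

Lemma chamber_count_triple n : chamber_count n 0 0 =
  triple_sum n 3 3 3 - triple_sum n 2 3 3 - triple_sum n 4 3 2 + triple_sum n 1 4 3
  + triple_sum n 4 3 1 - triple_sum n 1 5 3 - triple_sum n 3 6 0 + triple_sum n 2 6 0
  + triple_sum n 4 5 0 + triple_sum n 1 6 2 - triple_sum n 5 5 1 - triple_sum n 1 6 1.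
Proof.
rewrite -!step_count_triple // /chamber_count /orbit !big_cons big_nil.
by move: (step_count n) => c /=; ring.
Qed.

Lemma triple_sum_opp n (i j l : nat) : (i <= 6)%N -> (j <= 6)%N -> (l <= 6)%N ->
  triple_sum n i j l = triple_sum n (6 - i) (6 - j) (6 - l).
Proof.
move=> i6 j6 l6; rewrite -!step_count_triple ?leq_subr // step_count_opp -!subzn //.
by congr step_count; ring.
Qed.

Lemma triple_sumC n (i j l : nat) : triple_sum n i j l = triple_sum n j i l.
Proof. by apply: eq_bigr => k _; rewrite (mulrC (binz _ _)). Qed.

Lemma triple_sumAC n (i j l : nat) : triple_sum n i j l = triple_sum n i l j.
Proof. by apply: eq_bigr => k _; rewrite mulrAC. Qed.

Definition franel n := (\sum_(k < n.+1) 'C(n, k) ^ 3)%N.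

Definition franel_moment n : int :=
  \sum_(k < n.+1) k%:Z * (n%:Z - k%:Z) * 'C(n, k)%:Z ^+ 3.

Lemma franelE n : (franel n)%:Z = \sum_(k < n.+1) 'C(n, k)%:Z ^+ 3.
Proof.
rewrite /franel -natz natr_sum; apply: eq_bigr => k _.
by rewrite natrX natz.
Qed.

Lemma mul_binz_S n (k : nat) :
  (k%:Z + 1) * 'C(n, k.+1)%:Z = (n%:Z - k%:Z) * 'C(n, k)%:Z.
Proof.
have [kn|nk] := leqP k n; last by rewrite !bin_small ?mulr0 //; lia.
by rewrite subzn // -PoszD -!PoszM addn1 mul_bin_left.
Qed.

(** Since (n - k) C(n, k) = (k + 1) C(n, k + 1), the summand is G(k + 1) - G(k), where G vanishes at
    0 by the factor k^3 and at n + 1 by the binomial. *)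
Lemma sum_telescope_bin n (g : int -> int) :
  \sum_(k < n.+1) (g (k%:Z + 1) * (n%:Z - k%:Z) ^+ 3 - g k%:Z * k%:Z ^+ 3)
     * 'C(n, k)%:Z ^+ 3 = 0.
Proof.
pose G k := g k%:Z * k%:Z ^+ 3 * 'C(n, k)%:Z ^+ 3.
rewrite (eq_bigr (fun k : 'I_n.+1 => G k.+1 - G k)) => [|k _].
  rewrite -(big_mkord predT (fun k => G k.+1 - G k)) telescope_sumr //.
  by rewrite /G bin_small // !expr0n /= !mulr0 mul0r subrr.
rewrite /G -(mulrA (g k.+1%:Z)) -exprMn (_ : k.+1%:Z = k%:Z + 1); last by rewrite intS addrC.
rewrite mul_binz_S exprMn; ring.
Qed.

Lemma franel_pred n : n.+1%:Z ^+ 3 * (franel n)%:Z =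
  \sum_(k < n.+2) (n.+1%:Z - k%:Z) ^+ 3 * 'C(n.+1, k)%:Z ^+ 3.
Proof.
rewrite franelE mulr_sumr [RHS]big_ord_recr /= subrr expr0n mul0r addr0.
by apply: eq_bigr => k _; rewrite -!exprMn (binz_up n k%:Z).
Qed.

Lemma franel_pred_sym n : n.+1%:Z ^+ 3 * (franel n)%:Z =
  \sum_(k < n.+2) k%:Z ^+ 3 * 'C(n.+1, k)%:Z ^+ 3.
Proof.
rewrite franel_pred (reindex_inj rev_ord_inj) /=; apply: eq_bigr => k _.
by rewrite subSS bin_sub -1?ltnS // -subzn -1?ltnS // opprB addrCA subrr addr0.
Qed.

(** With N = n + 1, 3 N k (N - k) = N^3 - (N - k)^3 - k^3, and the two subtracted cubes both sum to
    N^3 times the preceding Franel number. *)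
Lemma franel_momentE n : 3 * franel_moment n.+1 =
  n.+1%:Z ^+ 2 * ((franel n.+1)%:Z - 2 * (franel n)%:Z).
Proof.
have N0 : n.+1%:Z != 0 by [].
apply: (mulfI N0); transitivity (n.+1%:Z ^+ 3 * (franel n.+1)%:Z
    - n.+1%:Z ^+ 3 * (franel n)%:Z - n.+1%:Z ^+ 3 * (franel n)%:Z); last by ring.
rewrite {1}franel_pred franel_pred_sym franelE !mulr_sumr -!sumrB.
by apply: eq_bigr => k _; ring.
Qed.

Lemma franel_pred2 n : (n%:Z + 1) ^+ 3 * (n%:Z + 2) ^+ 3 * (franel n)%:Z =
  \sum_(k < n.+3) k%:Z ^+ 3 * (n%:Z + 2 - k%:Z) ^+ 3 * 'C(n.+2, k)%:Z ^+ 3.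
Proof.
rewrite franelE (eq_bigr (fun k : 'I_n.+1 => binz n ((k + 1)%N%:Z - 1) ^+ 3)); last first.
  by move=> k _; rewrite PoszD addrK.
rewrite -(@sum_window _ (fun k => binz n (k%:Z - 1) ^+ 3) n.+1 1 n.+3); first last.
- by move=> k h; rewrite binz_small ?expr0n //; lia.
- by lia.
rewrite mulr_sumr; apply: eq_bigr => k _; rewrite -!exprMn; congr (_ ^+ 3).
have := @binz_falls n 2 1 k isT; rewrite !fallsS !falls0 !mulr1 /= addn2 => E.
rewrite -[X in X * binz _ _](_ : n.+2%:Z * (n.+2%:Z - 1) = _) ?E ?intS; ring.
Qed.

Lemma franel_rec n : (n%:Z + 2) ^+ 2 * (franel n.+2)%:Z =
  (7 * (n%:Z + 1) ^+ 2 + 7 * (n%:Z + 1) + 2) * (franel n.+1)%:Z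
  + 8 * (n%:Z + 1) ^+ 2 * (franel n)%:Z.
Proof.
(* Zeilberger certificate for C(n + 2, k)^3. The two earlier Franel numbers are written as moments
   of this cube; [franel n.+1] enters once in each of its two mirror forms, to keep the summand
   symmetric under k -> n + 2 - k. *)
pose q (k : int) := (2 * k - (n%:Z + 3))
  * (n%:Z * (5 * n%:Z + 9) + 4 * (k * (n%:Z + 3 - k))).
have N2 : n.+2%:Z = n%:Z + 2 by rewrite !intS; ring.
have := sum_telescope_bin n.+2 q; rewrite N2.
have -> : \sum_(k < n.+3) (q (k%:Z + 1) * (n%:Z + 2 - k%:Z) ^+ 3 - q k%:Z * k%:Z ^+ 3)
      * 'C(n.+2, k)%:Z ^+ 3
  = 2 * (n%:Z + 1) * (n%:Z + 2) ^+ 5 * (franel n.+2)%:Z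
    - (7 * (n%:Z + 1) ^+ 2 + 7 * (n%:Z + 1) + 2) * (n%:Z + 1)
      * (n.+2%:Z ^+ 3 * (franel n.+1)%:Z + n.+2%:Z ^+ 3 * (franel n.+1)%:Z)
    - 16 * ((n%:Z + 1) ^+ 3 * (n%:Z + 2) ^+ 3 * (franel n)%:Z).
  rewrite {1}franel_pred franel_pred_sym franel_pred2 franelE.
  rewrite -big_split !mulr_sumr -!sumrB; apply: eq_bigr => k _; rewrite /q N2 /=; ring.
rewrite N2 => E; have nz : 2 * (n%:Z + 1) * (n%:Z + 2) ^+ 3 != 0.
  by rewrite !mulf_neq0 ?expf_neq0 //; lia.
apply: (mulfI nz); apply/eqP; rewrite -subr_eq0; apply/eqP; rewrite -[RHS]E; ring.
Qed.

Lemma triple_sum_falls n (i j l : nat) : (i <= 6)%N -> (j <= 6)%N -> (l <= 6)%N ->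
  let p k i := falls k i * falls ((n + 6)%N%:Z - k) (6 - i) in
  falls (n + 6)%N%:Z 6 ^+ 3 * triple_sum n i j l =
  \sum_(k < (n + 6).+1) p k%:Z i * p k%:Z j * p k%:Z l * 'C(n + 6, k)%:Z ^+ 3.
Proof.
move=> i6 j6 l6 p; rewrite mulr_sumr; apply: eq_bigr => k _.
set D := falls _ _; transitivity ((D * binz n (k%:Z - i%:Z)) * (D * binz n (k%:Z - j%:Z))
    * (D * binz n (k%:Z - l%:Z))); first by ring.
by rewrite !binz_falls // /p /=; ring.
Qed.

Lemma sum_franel N (a b c : int) (T : 'I_N.+1 -> int) :
  a * (b * franel_moment N - c * (franel N)%:Z) + \sum_(k < N.+1) T k
  = \sum_(k < N.+1) (a * (b * (k%:Z * (N%:Z - k%:Z)) - c) * 'C(N, k)%:Z ^+ 3 + T k).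
Proof.
rewrite big_split; congr (_ + _); rewrite franelE /franel_moment !mulr_sumr -sumrB mulr_sumr.
by apply: eq_bigr => k _; ring.
Qed.

(** Summing [enhanced_certificateP] against the cubes of C(m + 3, k) makes the certificate
    disappear, and [franel_momentE] exchanges the remaining moment for [franel (n + 5)]. *)
Lemma chamber_count_franel n : let m := n%:Z + 3 in
  (m - 2) * (m - 1) * m ^+ 2 * (m + 1) ^+ 2 * (m + 2) ^+ 2 * chamber_count n 0 0
  = (m + 3) * (3 * m ^+ 4 + 13 * m ^+ 3 + 10 * m ^+ 2 - 7 * m - 5) * (franel (n + 6))%:Z
    - (24 * m ^+ 5 + 152 * m ^+ 4 + 296 * m ^+ 3 + 115 * m ^+ 2 - 157 * m - 84)
      * (franel (n + 5))%:Z.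
Proof.
move=> m.
have Em : (n + 6)%N%:Z = m + 3 by rewrite /m PoszD; ring.
have Ts : 2 * chamber_count n 0 0 =
    \sum_(c <- enhanced_terms) c.1 * triple_sum n c.2.1.1 c.2.1.2 c.2.2.
  rewrite /enhanced_terms !big_cons big_nil /=.
  rewrite chamber_count_triple.
  have s233 : triple_sum n 3 3 4 = triple_sum n 2 3 3.
    by rewrite triple_sum_opp // triple_sumAC triple_sumC.
  have s432 : triple_sum n 4 3 2 = triple_sum n 2 3 4.
    by rewrite triple_sumC triple_sumAC triple_sumC.
  have s143 : triple_sum n 1 4 3 = triple_sum n 1 3 4 by rewrite triple_sumAC.
  have s431 : triple_sum n 4 3 1 = triple_sum n 2 3 5 by rewrite triple_sum_opp.
  have s153 : triple_sum n 1 5 3 = triple_sum n 1 3 5 by rewrite triple_sumAC.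
  have s360 : triple_sum n 3 6 0 = triple_sum n 0 3 6.
    by rewrite triple_sumAC triple_sumC.
  have s260 : triple_sum n 2 6 0 = triple_sum n 0 2 6.
    by rewrite triple_sumAC triple_sumC.
  have s046 : triple_sum n 0 4 6 = triple_sum n 0 2 6.
    by rewrite triple_sum_opp // triple_sumC s260.
  have s450 : triple_sum n 4 5 0 = triple_sum n 0 4 5.
    by rewrite triple_sumAC triple_sumC.
  have s162 : triple_sum n 1 6 2 = triple_sum n 1 2 6 by rewrite triple_sumAC.
  have s551 : triple_sum n 5 5 1 = triple_sum n 1 1 5 by rewrite triple_sum_opp.
  have s155 : triple_sum n 1 5 5 = triple_sum n 1 1 5.
    by rewrite triple_sum_opp // triple_sumC triple_sumAC.
  have s161 : triple_sum n 1 6 1 = triple_sum n 1 1 6 by rewrite triple_sumAC.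
  have s055 : triple_sum n 0 5 5 = triple_sum n 1 1 6.
    by rewrite triple_sum_opp // triple_sumC triple_sumAC.
  by rewrite s233 s432 s143 s431 s153 s360 s260 s046 s450 s162 s551 s155 s161 s055; ring.
have {}Ts : falls (m + 3) 6 ^+ 3 * (2 * chamber_count n 0 0) =
    3 * (m - 2) ^+ 2 * (m - 1) ^+ 2 * m * (m + 1) * (m + 2) * (m + 3)
    * ((24 * m ^+ 5 + 152 * m ^+ 4 + 296 * m ^+ 3 + 115 * m ^+ 2 - 157 * m - 84)
         * franel_moment (n + 6)
       - (m + 2) * (m + 3) ^+ 2 * (6 * m ^+ 4 + 24 * m ^+ 3 + 18 * m ^+ 2 - 13 * m - 9)
         * (franel (n + 6))%:Z).
  have Z := sum_telescope_bin (n + 6) (enhanced_certificate m).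
  rewrite Ts -[RHS]addr0 -[X in _ = _ + X]Z sum_franel.
  rewrite [LHS]mulr_sumr.
  transitivity (\sum_(c <- enhanced_terms) \sum_(k < (n + 6).+1)
      c.1 * (let p i := falls k%:Z i * falls ((n + 6)%N%:Z - k%:Z) (6 - i) in
             p c.2.1.1 * p c.2.1.2 * p c.2.2) * 'C(n + 6, k)%:Z ^+ 3).
    rewrite big_seq [RHS]big_seq; apply: eq_bigr => c cT.
    have /and3P[? ? ?] : [&& c.2.1.1 <= 6, c.2.1.2 <= 6 & c.2.2 <= 6]%N.
      by move: c cT; apply/allP.
    by rewrite mulrCA -Em triple_sum_falls // mulr_sumr; apply: eq_bigr => k _; apply: mulrA.
  rewrite exchange_big; apply: eq_bigr => k _; rewrite -mulr_suml Em.
  by rewrite enhanced_certificateP -[RHS]mulrDl -addrA.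
have := franel_momentE (n + 5); rewrite -addnS Em => M3.
have nz : 6 * (m - 2) ^+ 2 * (m - 1) ^+ 2 * m * (m + 1) * (m + 2) * (m + 3) ^+ 3 != 0.
  by rewrite !mulf_neq0 ?expf_neq0 // /m; lia.
have F : falls (m + 3) 6 = (m + 3) * (m + 2) * (m + 1) * m * (m - 1) * (m - 2).
  by rewrite /falls !big_ord_recr big_ord0 /=; ring.
apply: (mulfI nz); move: Ts M3 {Em nz}; rewrite F {F}.
move: m (chamber_count n 0 0) (franel_moment _) (franel (n + 6))%:Z (franel (n + 5))%:Z.
move=> m w mom f6 f5 Ts M3.
transitivity (3 * (((m + 3) * (m + 2) * (m + 1) * m * (m - 1) * (m - 2)) ^+ 3 * (2 * w))).
  by ring.
rewrite Ts; transitivity (3 * (m - 2) ^+ 2 * (m - 1) ^+ 2 * m * (m + 1) * (m + 2) * (m + 3)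
   * ((24 * m ^+ 5 + 152 * m ^+ 4 + 296 * m ^+ 3 + 115 * m ^+ 2 - 157 * m - 84)
        * (3 * mom)
      - 3 * ((m + 2) * (m + 3) ^+ 2
         * (6 * m ^+ 4 + 24 * m ^+ 3 + 18 * m ^+ 2 - 13 * m - 9) * f6))); first by ring.
by rewrite M3; ring.
Qed.

(** The Franel recurrence expresses all quantities through [f5] and [f6], so any three of them are
    linearly dependent. Both relations become polynomial identities once multiplied by the nonzero
    denominators and freed of [f8], then [f7]. *)
Lemma franel_elimination (m w0 w1 w2 f5 f6 f7 f8 : int) : 3 <= m ->
  let c x := (x - 2) * (x - 1) * x ^+ 2 * (x + 1) ^+ 2 * (x + 2) ^+ 2 in
  let a x := (x + 3) * (3 * x ^+ 4 + 13 * x ^+ 3 + 10 * x ^+ 2 - 7 * x - 5) in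
  let b x := 24 * x ^+ 5 + 152 * x ^+ 4 + 296 * x ^+ 3 + 115 * x ^+ 2 - 157 * x - 84 in
  c m * w0 = a m * f6 - b m * f5 ->
  c (m + 1) * w1 = a (m + 1) * f7 - b (m + 1) * f6 ->
  c (m + 2) * w2 = a (m + 2) * f8 - b (m + 2) * f7 ->
  (m + 4) ^+ 2 * f7 = (7 * (m + 3) ^+ 2 + 7 * (m + 3) + 2) * f6 + 8 * (m + 3) ^+ 2 * f5 ->
  (m + 5) ^+ 2 * f8 = (7 * (m + 4) ^+ 2 + 7 * (m + 4) + 2) * f7 + 8 * (m + 4) ^+ 2 * f6 ->
  8 * m * (m - 2) * w0 + (7 * m ^+ 2 + 11 * m - 8) * w1 - (m + 5) * (m + 4) * w2 = 0
  /\ 15 * f5 = (m - 2) * m * (3 * m ^+ 4 + 28 * m ^+ 3 + 85 * m ^+ 2 + 88 * m + 20) * w0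
     + (m + 3) * (m + 4) * (3 * m ^+ 4 + 13 * m ^+ 3 + 10 * m ^+ 2 - 7 * m - 5) * w1.
Proof.
move=> m3 c a b E0 E1 E2 F7 F8.
have c_neq0 x : 3 <= x -> c x != 0.
  by move=> x3; rewrite /c !mulf_neq0 ?expf_neq0 //; lia.
have m45 : (m + 4) ^+ 2 != 0 /\ (m + 5) ^+ 2 != 0 by rewrite !expf_neq0; lia.
case: m45 => m4 m5; split.
  have nz : (m + 4) ^+ 2 * (m + 5) ^+ 2 * (c m * c (m + 1) * c (m + 2)) != 0.
    by rewrite !mulf_neq0 ?c_neq0 //; lia.
  apply: (mulfI nz); rewrite mulr0.
  transitivity ((m + 4) ^+ 2 * (m + 5) ^+ 2 *
    (8 * m * (m - 2) * c (m + 1) * c (m + 2) * (c m * w0)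
     + (7 * m ^+ 2 + 11 * m - 8) * c m * c (m + 2) * (c (m + 1) * w1)
     - (m + 5) * (m + 4) * c m * c (m + 1) * (c (m + 2) * w2))); first by ring.
  rewrite E0 E1 E2; transitivity ((m + 4) ^+ 2 * (m + 5) ^+ 2 *
    (8 * m * (m - 2) * c (m + 1) * c (m + 2) * (a m * f6 - b m * f5)
     - (7 * m ^+ 2 + 11 * m - 8) * c m * c (m + 2) * b (m + 1) * f6)
    + (m + 5) ^+ 2 * ((7 * m ^+ 2 + 11 * m - 8) * c m * c (m + 2) * a (m + 1)
         + (m + 5) * (m + 4) * c m * c (m + 1) * b (m + 2)) * ((m + 4) ^+ 2 * f7)
    - (m + 4) ^+ 2 * (m + 5) * (m + 4) * c m * c (m + 1) * a (m + 2)
         * ((m + 5) ^+ 2 * f8)); first by ring.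
  rewrite F8 mulrDr [X in _ - X]mulrDr.
  transitivity ((m + 4) ^+ 2 * (m + 5) ^+ 2 *
    (8 * m * (m - 2) * c (m + 1) * c (m + 2) * (a m * f6 - b m * f5)
     - (7 * m ^+ 2 + 11 * m - 8) * c m * c (m + 2) * b (m + 1) * f6)
    + ((m + 5) ^+ 2 * ((7 * m ^+ 2 + 11 * m - 8) * c m * c (m + 2) * a (m + 1)
         + (m + 5) * (m + 4) * c m * c (m + 1) * b (m + 2))
       - (m + 5) * (m + 4) * c m * c (m + 1) * a (m + 2)
         * (7 * (m + 4) ^+ 2 + 7 * (m + 4) + 2)) * ((m + 4) ^+ 2 * f7)
    - (m + 4) ^+ 2 * (m + 5) * (m + 4) * c m * c (m + 1) * a (m + 2)
         * (8 * (m + 4) ^+ 2 * f6)); first by ring.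
  by rewrite F7 /c /a /b; ring.
have nz : (m + 4) ^+ 2 * (c m * c (m + 1)) != 0.
  by rewrite !mulf_neq0 ?c_neq0 //; lia.
apply: (mulfI nz).
transitivity ((m + 4) ^+ 2 *
  ((m - 2) * m * (3 * m ^+ 4 + 28 * m ^+ 3 + 85 * m ^+ 2 + 88 * m + 20)
     * c (m + 1) * (c m * w0)
   + (m + 3) * (m + 4) * (3 * m ^+ 4 + 13 * m ^+ 3 + 10 * m ^+ 2 - 7 * m - 5)
     * c m * (c (m + 1) * w1))); last by ring.
rewrite E0 E1.
transitivity ((m + 4) ^+ 2 *
  ((m - 2) * m * (3 * m ^+ 4 + 28 * m ^+ 3 + 85 * m ^+ 2 + 88 * m + 20)
     * c (m + 1) * (a m * f6 - b m * f5)
   - (m + 3) * (m + 4) * (3 * m ^+ 4 + 13 * m ^+ 3 + 10 * m ^+ 2 - 7 * m - 5)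
     * c m * b (m + 1) * f6)
  + (m + 3) * (m + 4) * (3 * m ^+ 4 + 13 * m ^+ 3 + 10 * m ^+ 2 - 7 * m - 5)
     * c m * a (m + 1) * ((m + 4) ^+ 2 * f7)); last by ring.
by rewrite F7 /c /a /b; ring.
Qed.

Lemma chamber_count_elimination n :
  8 * (n%:Z + 3) * (n%:Z + 1) * chamber_count n 0 0
  + (7 * n%:Z ^+ 2 + 53 * n%:Z + 88) * chamber_count n.+1 0 0
  - (n%:Z + 8) * (n%:Z + 7) * chamber_count n.+2 0 0 = 0
  /\ let m := n%:Z + 3 in 15 * (franel (n + 5))%:Z =
    (m - 2) * m * (3 * m ^+ 4 + 28 * m ^+ 3 + 85 * m ^+ 2 + 88 * m + 20) * chamber_count n 0 0
    + (m + 3) * (m + 4) * (3 * m ^+ 4 + 13 * m ^+ 3 + 10 * m ^+ 2 - 7 * m - 5)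
      * chamber_count n.+1 0 0.
Proof.
have e1 : n.+1%:Z + 3 = n%:Z + 3 + 1 by rewrite intS; ring.
have e2 : n.+2%:Z + 3 = n%:Z + 3 + 2 by rewrite !intS; ring.
have E0 := chamber_count_franel n; have := chamber_count_franel n.+1; rewrite e1 => E1.
have := chamber_count_franel n.+2; rewrite e2 => E2.
move: E1 E2; rewrite !addSn -!addnS => E1 E2.
have e5 : (n + 5)%N%:Z = n%:Z + 3 + 2 by rewrite PoszD; ring.
have e6 : (n + 6)%N%:Z = n%:Z + 3 + 3 by rewrite PoszD; ring.
have := franel_rec (n + 5); rewrite -!addnS e5 => F7.
have := franel_rec (n + 6); rewrite -!addnS e6 => F8.
have m3 : 3 <= n%:Z + 3 by lia.
have := franel_elimination m3 E0 E1 E2.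
case.
- transitivity ((n%:Z + 3 + 2 + 2) ^+ 2 * (franel (n + 7))%:Z); first by ring.
  by rewrite F7; ring.
- transitivity ((n%:Z + 3 + 3 + 2) ^+ 2 * (franel (n + 8))%:Z); first by ring.
  by rewrite F8; ring.
move=> R1 R2; split=> //; rewrite -[RHS]R1.
move: (chamber_count n 0 0) (chamber_count n.+1 0 0) (chamber_count n.+2 0 0) => w0 w1 w2.
ring.
Qed.

(** * MacMahon's formula for Franel numbers and its first-order substitute *)

Section MacMahon.
Variable R : realFieldType.

Lemma bin_upR n k :
  n.+1%:R * 'C(n, k)%:R = (n.+1%:R - k%:R) * 'C(n.+1, k)%:R :> R.
Proof.
have := congr1 (fun z : int => z%:~R : R) (binz_up n k).
by rewrite !rmorphM rmorphB /= !pmulrn.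
Qed.

Lemma bin_nextR n k : k.+1%:R * 'C(n, k.+1)%:R = (n%:R - k%:R) * 'C(n, k)%:R :> R.
Proof.
have := congr1 (fun z : int => z%:~R : R) (mul_binz_S n k).
by rewrite !rmorphM rmorphB rmorphD /= -natr1 !pmulrn.
Qed.

Definition trinomial k : R := (3 * k)`!%:R / k`!%:R ^+ 3.

Lemma trinomialS k : k.+1%:R ^+ 3 * trinomial k.+1 =
  (3 * k%:R + 1) * (3 * k%:R + 2) * (3 * k%:R + 3) * trinomial k.
Proof.
have k0 : k`!%:R != 0 :> R by rewrite pnatr_eq0 -lt0n fact_gt0.
rewrite /trinomial (_ : 3 * k.+1 = (3 * k).+3)%N; last by rewrite mulnS.
have : (3 * k)%:R = 3 * k%:R :> R by rewrite natrM.
move: (3 * k)%N => k3 k3E.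
rewrite !factS !natrM -[k3.+3]addn3 -[k3.+2]addn2 -[k3.+1]addn1 !natrD k3E.
rewrite -[k.+1%:R]natr1; have : 0 <= k%:R :> R by [].
move: (k3`!%:R : R) (k`!%:R : R) k0 => z y y0; move: (k%:R : R) => x x0.
by field; rewrite y0 /=; apply: lt0r_neq0; lra.
Qed.

Definition macmahon_term n k : R := trinomial k / 4 ^+ k * 'C(n + k, 3 * k)%:R * 2 ^+ n.

Definition macmahon n : R := \sum_(k < n.+1) macmahon_term n k.

Lemma macmahon_wide N n : (n < N)%N -> macmahon n = \sum_(k < N) macmahon_term n k.
Proof.
move=> nN; rewrite /macmahon (big_ord_widen N (macmahon_term n)) // big_mkcond.
apply: eq_bigr => k _; case: ltnP => // nk.
by rewrite /macmahon_term bin_small ?mulr0 ?mul0r //; lia.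
Qed.

Lemma macmahon_rec n : (n%:R + 2) ^+ 2 * macmahon n.+2 =
  (7 * (n%:R + 1) ^+ 2 + 7 * (n%:R + 1) + 2) * macmahon n.+1
  + 8 * (n%:R + 1) ^+ 2 * macmahon n.
Proof.
have [lt1 lt2] : (n < n.+3)%N /\ (n.+1 < n.+3)%N by lia.
(* Zeilberger certificate of [macmahon_term]; it vanishes at 0 by the factor k^3 and at n + 3 by the
   binomial. *)
pose G k : R := - 24 * (3 * n%:R + 4) * k%:R ^+ 3 * (trinomial k / 4 ^+ k)
  * 'C(n.+2 + k, 3 * k)%:R * 2 ^+ n / ((n%:R + 1 + k%:R) * (n%:R + 2 + k%:R)).
rewrite (macmahon_wide lt1) (macmahon_wide lt2) (@macmahon_wide n.+3 n.+2) //; apply/eqP.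
rewrite -subr_eq0 opprD addrA !mulr_sumr -!sumrB.
rewrite (eq_bigr (fun k : 'I_n.+3 => G k.+1 - G k)) => [|k _].
  rewrite -(big_mkord predT (fun k => G k.+1 - G k)) telescope_sumr // /G.
  by rewrite bin_small; [rewrite expr0n /= !(mulr0, mul0r) subrr | lia].
move: (nat_of_ord k) => {}k; rewrite /macmahon_term /G.
have n0 : 0 <= n%:R :> R by []; have k0 : 0 <= k%:R :> R by [].
have e1 : (n%:R + 2 + k%:R) * 'C(n.+1 + k, 3 * k)%:R
    = (n%:R + 2 - 2 * k%:R) * 'C(n.+2 + k, 3 * k)%:R :> R.
  have := bin_upR (n.+1 + k) (3 * k); rewrite natrM -addSn [(n.+2 + k)%:R]natrD -[n.+2]addn2.
  rewrite [(n + 2)%:R]natrD => ->; congr (_ * _); ring.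
have e0 : (n%:R + 1 + k%:R) * 'C(n + k, 3 * k)%:R
    = (n%:R + 1 - 2 * k%:R) * 'C(n.+1 + k, 3 * k)%:R :> R.
  have := bin_upR (n + k) (3 * k); rewrite natrM -addSn [(n.+1 + k)%:R]natrD -[n.+1]addn1.
  rewrite [(n + 1)%:R]natrD => ->; congr (_ * _); ring.
have e3 : (3 * k%:R + 3) * (3 * k%:R + 2) * (3 * k%:R + 1)
      * 'C(n.+2 + k.+1, 3 * k.+1)%:R
    = (n%:R + 3 + k%:R) * (n%:R + 2 - 2 * k%:R) * (n%:R + 1 - 2 * k%:R)
      * 'C(n.+2 + k, 3 * k)%:R :> R.
  rewrite addnS (_ : 3 * k.+1 = (3 * k).+3)%N; last by rewrite mulnS.
  have f1 := bin_nextR (n.+2 + k) (3 * k); have f2 := bin_nextR (n.+2 + k) (3 * k).+1.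
  have f3 : (3 * k).+3%:R * 'C((n.+2 + k).+1, (3 * k).+3)%:R
      = (n.+2 + k).+1%:R * 'C(n.+2 + k, (3 * k).+2)%:R :> R.
    by rewrite -!natrM -mul_bin_diag.
  have : (3 * k)%:R = 3 * k%:R :> R by rewrite natrM.
  have : (n.+2 + k)%:R = n%:R + 2 + k%:R :> R by rewrite natrD -addn2 natrD.
  move: (3 * k)%N (n.+2 + k)%N f1 f2 f3 => k3 nk.
  rewrite -[nk.+1]addn1 -[k3.+3]addn3 -[k3.+2]addn2 -[k3.+1]addn1 !natrD.
  move=> f1 f2 f3 enk e3; move: f1 f2 f3; rewrite enk e3.
  move: 'C(_, k3 + 1)%:R 'C(_, k3 + 2)%:R 'C(_, k3 + 3)%:R 'C(_, k3)%:R => c1 c2 c3 c0 f1 f2 f3.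
  transitivity ((3 * k%:R + 2) * (3 * k%:R + 1) * ((3 * k%:R + 3) * c3)); first by ring.
  rewrite f3; transitivity ((3 * k%:R + 1) * (n%:R + 3 + k%:R) * ((3 * k%:R + 2) * c2)).
    by ring.
  rewrite f2; transitivity ((n%:R + 3 + k%:R) * (n%:R + 1 - 2 * k%:R) * ((3 * k%:R + 1) * c1)).
    by ring.
  by rewrite f1; ring.
have := trinomialS k; rewrite -[k.+1%:R]natr1 !(exprS _ k) !(exprS _ n.+1) !(exprS _ n).
have : 4 ^+ k != 0 :> R by rewrite expf_neq0 ?pnatr_eq0.
move: e0 e1 e3 {G}.
move: 'C(n + k, _)%:R 'C(n.+1 + k, _)%:R 'C(n.+2 + k, _)%:R 'C(n.+2 + k.+1, _)%:R.
move: (trinomial _) (trinomial _) (4 ^+ k) (2 ^+ n) n%:R k%:R n0 k0.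
move=> t0 t1 e p x y x0 y0 b0 b1 b2 b3 E0 E1 E3 e0 T.
have y1 : (y + 1) ^+ 3 != 0 by rewrite expf_neq0 // lt0r_neq0 //; lra.
have x2 : x + 2 + y != 0 by rewrite lt0r_neq0 //; lra.
have x1 : x + 1 + y != 0 by rewrite lt0r_neq0 //; lra.
have y3 : (3 * y + 3) * (3 * y + 2) * (3 * y + 1) != 0.
  by rewrite !mulf_neq0 // lt0r_neq0 //; lra.
have {}E1 : b1 = (x + 2 - 2 * y) * b2 / (x + 2 + y) by rewrite -E1 mulrC mulKf.
have {}E0 : b0 = (x + 1 - 2 * y) * b1 / (x + 1 + y) by rewrite -E0 mulrC mulKf.
have {}E3 : b3 = (x + 3 + y) * (x + 2 - 2 * y) * (x + 1 - 2 * y) * b2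
    / ((3 * y + 3) * (3 * y + 2) * (3 * y + 1)) by rewrite -E3 mulrC mulKf.
have {}T : t1 = (3 * y + 1) * (3 * y + 2) * (3 * y + 3) * t0 / (y + 1) ^+ 3.
  by rewrite -T mulrC mulKf.
rewrite T E3 E0 E1; field.
by rewrite e0 /=; do ?[apply/andP; split]; apply: lt0r_neq0; lra.
Qed.

Lemma franel_macmahon n : (franel n)%:R = macmahon n.
Proof.
suff : (franel n)%:R = macmahon n /\ (franel n.+1)%:R = macmahon n.+1 by case.
elim: n => [|n [IH0 IH1]].
  have -> : franel 0 = 1%N by rewrite /franel big_ord1.
  have -> : franel 1 = 2%N by rewrite /franel !big_ord_recr big_ord0.
  have t0 : trinomial 0 = 1 by rewrite /trinomial !fact0 expr1n divr1.
  rewrite /macmahon !big_ord_recr !big_ord0 /macmahon_term /= t0 (@bin_small (1 + 1) _) //.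
  by rewrite !bin0; split; field.
split=> //; have n2 : (n%:R + 2) ^+ 2 != 0 :> R.
  by rewrite expf_neq0 // lt0r_neq0 // ltr_wpDl.
apply: (mulfI n2); rewrite macmahon_rec -IH0 -IH1.
have := congr1 (fun z : int => z%:~R : R) (franel_rec n).
by rewrite !(rmorphM, rmorphD, rmorphXn) /= !pmulrn.
Qed.

Definition ratio27 : R := 27 / 4.

(* The terms of [macmahon] with (3k)! / k! ^ 3 replaced by 27 ^ k / k, up to the
   constant factor [trinomial_ratio] converges to; unlike [macmahon], their sum
   satisfies a first-order recurrence. *)
Definition log_term n k : R :=
  ratio27 ^+ k.+1 / k.+1%:R * 'C(n.+1 + k, 3 * k + 3)%:R * 2 ^+ n.

Definition log_sum n : R := \sum_(k < n.+1) log_term n k.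

Definition trinomial_ratio k : R := k.+1%:R * trinomial k.+1 / 27 ^+ k.+1.

Lemma franel_log_sum n :
  (franel n)%:R = 2 ^+ n + \sum_(k < n.+1) trinomial_ratio k * log_term n k.
Proof.
rewrite franel_macmahon (@macmahon_wide n.+2) // big_ord_recl; congr (_ + _).
  by rewrite /macmahon_term /trinomial /= muln0 bin0 !fact0 expr1n !divr1 !mul1r.
apply: eq_bigr => k _; rewrite lift0 /macmahon_term /trinomial_ratio /log_term.
rewrite -addSnnS (_ : 3 * k.+1 = 3 * k + 3)%N; last by rewrite mulnS addnC.
rewrite /ratio27 expr_div_n; field.
by rewrite !expf_neq0 ?pnatr_eq0 // andbT lt0r_neq0 // ltr_pwDl.
Qed.

Section ClosedForm.
Variable N : nat.

Definition trisect_sum c m : R := \sum_(k < N) ratio27 ^+ k.+1 * 'C(m + k, 3 * k + c)%:R.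

Lemma trisect_sumS c m :
  trisect_sum c.+1 m.+1 = trisect_sum c.+1 m + trisect_sum c m.
Proof.
rewrite -big_split; apply: eq_bigr => k _ /=.
by rewrite addSn addnS binS natrD mulrDr.
Qed.

Lemma trisect_sum_wrap m : (m < N)%N ->
  trisect_sum 0 m = ratio27 * (1 + trisect_sum 3 m.+1).
Proof.
move=> mN; rewrite /trisect_sum; case: N mN => // M mM.
rewrite big_ord_recl [in RHS]big_ord_recr /= (@bin_small (m.+1 + M)) ?mulr0 ?addr0; last by lia.
rewrite muln0 bin0 mulr1 expr1 mulrDr mulr1 mulr_sumr; congr (_ + _).
apply: eq_bigr => k _.
by rewrite mulrA -exprS /bump /= add1n addnS addSn addn0 mulnS (addnC 3).
Qed.

Lemma trisect_sum_closed m : (m <= N)%N ->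
  let u := (- 1 / 2) ^+ m in
  [/\ trisect_sum 3 m = 4 ^+ m / 9 + (8 / 9 - 2 * m%:R) * u - 1,
      trisect_sum 2 m = 4 ^+ m / 3 + (3 * m%:R - 1 / 3) * u
    & trisect_sum 1 m = 4 ^+ m - (1 + 9 / 2 * m%:R) * u].
Proof.
elim: m => [|m IH] mN u.
  have z c : (0 < c)%N -> trisect_sum c 0 = 0.
    move=> c0; rewrite /trisect_sum big1 // => k _.
    by rewrite bin_small ?mulr0 // add0n; lia.
  by rewrite !z // /u !expr0; split; field.
have [s3 s2 s1] := IH (ltnW mN).
have s3' : trisect_sum 3 m.+1 = 4 ^+ m.+1 / 9 + (8 / 9 - 2 * m.+1%:R) * u - 1.
  by rewrite trisect_sumS s3 s2 /u !exprS -natr1; field.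
split=> //; first by rewrite trisect_sumS s2 s1 /u !exprS -natr1; field.
by rewrite trisect_sumS s1 trisect_sum_wrap // s3' /u !exprS -natr1 /ratio27; field.
Qed.

End ClosedForm.

Lemma log_sum_wide N n : (n < N)%N -> log_sum n = \sum_(k < N) log_term n k.
Proof.
move=> nN; rewrite /log_sum (big_ord_widen N (log_term n)) // big_mkcond.
apply: eq_bigr => k _; case: ltnP => // nk.
by rewrite /log_term bin_small ?mulr0 ?mul0r //; lia.
Qed.

(** The difference in n lowers 3k + 3 to 3k + 2 in the binomial, and the denominator k + 1
    disappears because (n + 1) C(n+1+k, 3k+2) = (k + 1) (2 C(n+1+k, 3k+2) + 3 C(n+1+k, 3k+3)). What
    remains has a closed form. *)
Lemma log_sum_rec n : n.+1%:R * (log_sum n.+1 - 2 * log_sum n)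
  = 8 ^+ n.+1 + 2 * (- 1) ^+ n.+1 - 3 * 2 ^+ n.+1.
Proof.
transitivity (2 ^+ n.+1 * (2 * trisect_sum n.+2 2 n.+1 + 3 * trisect_sum n.+2 3 n.+1)).
  rewrite (@log_sum_wide n.+2 n.+1) // (log_sum_wide (leqnSn n.+1)).
  rewrite !mulr_sumr -sumrB !mulr_sumr -big_split mulr_sumr; apply: eq_bigr => k _ /=.
  have : (3 * k)%:R = 3 * k%:R :> R by rewrite natrM.
  rewrite /log_term (exprS 2 n); move: (3 * k)%N => k3 k3E.
  have p : 'C(n.+2 + k, k3 + 3)%:R = 'C(n.+1 + k, k3 + 3)%:R + 'C(n.+1 + k, k3 + 2)%:R :> R.
    by rewrite addSn (addnS _ 2) binS natrD.
  have := bin_nextR (n.+1 + k) (k3 + 2); rewrite -addnS !natrD k3E p.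
  move: 'C(_, k3 + 2)%:R 'C(_, k3 + 3)%:R => c2 c3.
  rewrite -[k.+1%:R]natr1 -[n.+1%:R]natr1.
  have : 0 <= k%:R :> R by []; move: k%:R n%:R (ratio27 ^+ _) (2 ^+ n) => x y q e x0 E.
  have x1 : x + 1 != 0 by rewrite lt0r_neq0 //; lra.
  have -> : c3 = (y - 1 - 2 * x) * c2 / (3 * (x + 1)).
    rewrite (_ : (y - 1 - 2 * x) * c2 = 3 * (x + 1) * c3); first by field.
    by transitivity ((3 * x + 3) * c3); [rewrite E|]; ring.
  by field.
have [-> -> _] := @trisect_sum_closed n.+2 n.+1 (leqnSn _).
rewrite (_ : (- 1) ^+ n.+1 = 2 ^+ n.+1 * (- 1 / 2) ^+ n.+1); last first.
  by rewrite -exprMn; congr (_ ^+ _); field.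
have -> : 8 ^+ n.+1 = 2 ^+ n.+1 * 4 ^+ n.+1 :> R by rewrite -exprMn; congr (_ ^+ _); ring.
by field.
Qed.

End MacMahon.

Local Open Scope classical_set_scope.
Local Open Scope ring_scope.

(** * The sine product at 1/3, by Wallis-type comparison *)

Section SineProduct.
Variable R : realType.
Implicit Types (f F : R -> R) (a x : R).

(** Serves as monotonicity of the integral, applied to differences of explicit antiderivatives. *)
Lemma le_derive f (df : R -> R) (u v : R) : u <= v ->
  (forall x, is_derive x 1 f (df x)) -> (forall x, u <= x <= v -> 0 <= df x) ->
  f u <= f v.
Proof.
move=> uv fd d0; have cf : {within `[u, v], continuous f}.
  apply: continuous_subspaceT => x; apply: differentiable_continuous.
  by apply/derivable1_diffP; case: (fd x).
have [c cuv E] := @MVT_segment R f df u v uv (fun x _ => fd x) cf.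
by rewrite -subr_ge0 E mulr_ge0 ?subr_ge0 // d0 // (itvP cuv).
Qed.

(* An antiderivative of cos (a x) cos x ^ (2 m) when [F] is one of cos (a x). *)
Fixpoint cos_prim a F m x : R :=
  if m is m'.+1 then
    (m.*2%:R * (cos x ^+ m'.*2.+1 * sin x * cos (a * x)) - a * (cos x ^+ m.*2 * sin (a * x))
     + m.*2%:R * m'.*2.+1%:R * cos_prim a F m' x) / (m.*2%:R ^+ 2 - a ^+ 2)
  else F x.

Lemma is_derive_mull a x : is_derive x 1 ( *%R a) a.
Proof.
have -> : *%R a = a *: (id : R -> R) by apply/funext => y.
by apply: trigger_derive; rewrite /GRing.scale /= mulr1.
Qed.

Lemma is_derive_cosM a x : is_derive x 1 (cos \o *%R a) (- (a * sin (a * x))).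
Proof.
apply: (trigger_derive (is_derive1_comp (is_derive_cos (a * x)) (is_derive_mull a x))).
by rewrite mulNr mulrC.
Qed.

Lemma is_derive_sinM a x : is_derive x 1 (sin \o *%R a) (a * cos (a * x)).
Proof.
apply: (trigger_derive (is_derive1_comp (is_derive_sin (a * x)) (is_derive_mull a x))).
by rewrite mulrC.
Qed.

Lemma cos_primS a F m : cos_prim a F m.+1 =
  (m.+1.*2%:R ^+ 2 - a ^+ 2)^-1 *:
  (m.+1.*2%:R *: (cos ^+ m.*2.+1 * sin * (cos \o *%R a))
   - a *: (cos ^+ m.+1.*2 * (sin \o *%R a))
   + (m.+1.*2%:R * m.*2.+1%:R) *: cos_prim a F m).
Proof.
by apply/funext => x /=; rewrite mulrC !fctE /GRing.scale.
Qed.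

Lemma is_derive_cos_prim a F m x : (forall y : R, is_derive y 1 F (cos (a * y))) ->
  `|a| < 2 ->
  is_derive x 1 (cos_prim a F m) (cos (a * x) * cos x ^+ m.*2).
Proof.
move=> dF a2; elim: m x => [|m IH] x.
  by apply: trigger_derive (dF x) _; rewrite mulr1.
rewrite cos_primS.
have := is_derive_cosM a x; have := is_derive_sinM a x; have {}IH := IH x => dS dC.
have dX n := is_deriveX n (is_derive_cos x).
have d1 := is_deriveM (is_deriveM (dX m.*2.+1) (is_derive_sin x)) dC.
have d2 := is_deriveM (dX m.+1.*2) dS.
apply: trigger_derive (is_deriveZ _ (is_deriveD (is_deriveB (is_deriveZ _ d1)
  (is_deriveZ _ d2)) (is_deriveZ _ IH))) _.
rewrite /GRing.scale /= !fctE /= doubleS !(exprS (cos x)).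
have s2 : sin x * sin x = 1 - cos x * cos x by rewrite -!expr2 sin2cos2.
have N2 : m.*2.+2%:R = m.*2%:R + 2 :> R by rewrite -addn2 natrD.
have N1 : m.*2.+1%:R = m.*2%:R + 1 :> R by rewrite -addn1 natrD.
rewrite N1 N2; have N0 : 0 <= m.*2%:R :> R by [].
move: (cos x ^+ m.*2) => p; move: (m.*2%:R) (cos x) (sin x) (cos (a * x)) (sin (a * x)) N0 s2.
move=> {IH dS dC N1 N2} N c s C S N0 s2.
have nz : (N + 2) ^+ 2 - a ^+ 2 != 0.
  by move: a2; rewrite ltr_norml => /andP[? ?]; apply: lt0r_neq0; nra.
apply: (mulfI nz); rewrite mulVKf //.
transitivity (((N + 2) ^+ 2 - a ^+ 2) * C * c * c * p
   + (N + 2) * (N + 1) * C * p * (1 - c * c - s * s)); first by ring.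
by rewrite s2; ring.
Qed.

Lemma cos_prim0 a F m : F 0 = 0 -> cos_prim a F m 0 = 0.
Proof.
move=> F0; elim: m => //= m ->.
by rewrite !(mulr0, sin0, mul0r, subr0, addr0).
Qed.

(** The boundary terms of the reduction formula contain a power of cos(pi / 2) = 0, so each step
    only multiplies by a constant. *)
Lemma cos_prim_pihalf a F m :
  cos_prim a F m (pi / 2) =
  F (pi / 2) * \prod_(j < m) (j.+1.*2%:R * j.*2.+1%:R / (j.+1.*2%:R ^+ 2 - a ^+ 2)).
Proof.
elim: m => [|m IH]; first by rewrite big_ord0 mulr1.
rewrite big_ord_recr /= IH cos_pihalf doubleS !expr0n /= !mul0r !mulr0 subr0 add0r.
ring.
Qed.

Lemma sin_third (x : R) : 0 <= x <= pi / 2 -> 0 <= sin (x / 3) <= sin x.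
Proof.
move=> /andP[x0 x2]; have p0 := pi_ge0 R.
apply/andP; split; first by apply: sin_ge0_pi; lra.
have [x_gt0|] := ltP 0 x; last by move=> ?; rewrite (_ : x = 0) ?mul0r //; lra.
by apply: ltW; rewrite ltr_sin ?in_itv /=; lra.
Qed.

(** The frequency 2/3 is chosen because (2j)^2 - (2/3)^2 = (2j)^2 (1 - 1 / (9 j^2)), the factor of
    [third_prod]. *)
Definition third_prim := cos_prim (2 / 3) (fun x => 3 / 2 * sin (2 / 3 * x)).

Definition zero_prim := cos_prim 0 id.

Lemma is_derive_third_prim m (x : R) :
  is_derive x 1 (third_prim m) (cos (2 / 3 * x) * cos x ^+ m.*2).
Proof.
apply: is_derive_cos_prim => [y|]; last by rewrite ger0_norm; lra.
have := is_deriveZ (3 / 2) (is_derive_sinM (2 / 3) y).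
by move/trigger_derive; apply; rewrite /GRing.scale /=; field.
Qed.

Lemma is_derive_zero_prim m (x : R) : is_derive x 1 (zero_prim m) (cos x ^+ m.*2).
Proof.
have -> : cos x ^+ m.*2 = cos (0 * x) * cos x ^+ m.*2 by rewrite mul0r cos0 mul1r.
apply: is_derive_cos_prim => [y|]; last by rewrite normr0.
by rewrite mul0r cos0; exact: is_derive_id.
Qed.

(* Compares the integrals over [0, pi/2] of cos x ^ (2 m) with those of
   cos (2 x / 3) cos x ^ (2 m), whose quotients are the partial products of
   sin (pi / 3) / (pi / 3). *)
Lemma zero_prim_bounds m : let z := zero_prim m.+1 (pi / 2) in
  let t := third_prim m.+1 (pi / 2) in
  0 <= z - t <= 2 * (zero_prim m (pi / 2) - z).
Proof.
have p0 := pi_ge0 R; have u : 0 <= pi / 2 :> R by lra.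
have third0 k : third_prim k 0 = 0 by apply: cos_prim0; rewrite mulr0 sin0 mulr0.
have zero0 k : zero_prim k 0 = 0 by apply: cos_prim0.
have half (x : R) : 1 - cos (2 / 3 * x) = 2 * sin (x / 3) ^+ 2.
  have -> : 2 / 3 * x = x / 3 + x / 3 by field.
  by rewrite cosD; have := cos2Dsin2 (x / 3); lra.
have c_ge0 (x : R) k : 0 <= cos x ^+ k.*2.
  by rewrite -mul2n exprM exprn_ge0 // sqr_ge0.
have d1 x := is_deriveB (is_derive_zero_prim m.+1 x) (is_derive_third_prim m.+1 x).
have d2 x := is_deriveB (is_derive_zero_prim m x) (is_derive_zero_prim m.+1 x).
have d3 x := is_deriveB (is_deriveZ 2 (d2 x)) (d1 x).
apply/andP; split.
  have := le_derive u d1; rewrite !fctE !third0 !zero0 subrr; apply => x _.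
  by rewrite -{1}(mul1r (cos x ^+ _)) -mulrBl half mulr_ge0 ?c_ge0 // mulr_ge0 ?sqr_ge0.
(* Upper bound: 1 - cos(2x/3) = 2 sin(x/3)^2 is at most 2 (sin x)^2, and (sin x)^2 (cos x)^(2m) is
   the derivative of the difference of consecutive [zero_prim]. *)
rewrite -subr_ge0.
have := le_derive u d3; rewrite !fctE /GRing.scale /= !third0 !zero0 !subrr scaler0 subrr.
apply => x xI; have /andP[s0 s1] := sin_third xI.
have -> : cos x ^+ m.+1.*2 = cos x ^+ 2 * cos x ^+ m.*2 by rewrite -exprD.
have -> : 2 * (cos x ^+ m.*2 - cos x ^+ 2 * cos x ^+ m.*2)
   - (cos x ^+ 2 * cos x ^+ m.*2 - cos (2 / 3 * x) * (cos x ^+ 2 * cos x ^+ m.*2))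
  = 2 * ((1 - cos x ^+ 2) - (1 - cos (2 / 3 * x)) / 2 * cos x ^+ 2) * cos x ^+ m.*2 by field.
rewrite mulr_ge0 ?c_ge0 // mulr_ge0 // half -sin2cos2.
have := cos2Dsin2 x; nra.
Qed.

Definition third_prod m : R := \prod_(j < m) (1 - (9 * j.+1%:R ^+ 2)^-1).

Lemma sin_pi3 : 2 * sin (pi / 3) = Num.sqrt 3 :> R.
Proof.
have p0 := pi_gt0 R; set s := sin (pi / 3).
have s0 : 0 < s by apply: sin_gt0_pi; lra.
have : sin (pi / 3 + (pi / 3 + pi / 3)) = 0 :> R.
  by rewrite -[RHS](sinpi R); congr sin; field.
rewrite !sinD !cosD -/s; have := cos2Dsin2 (pi / 3 : R); rewrite -/s.
move: (cos _) => c cs E.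
have s2 : (2 * s) ^+ 2 = 3.
  have /eqP : s * (3 - (2 * s) ^+ 2) = 0.
    rewrite -[RHS]E; transitivity (s * (3 * (c ^+ 2 + s ^+ 2) - (2 * s) ^+ 2)).
      by rewrite cs mulr1.
    by ring.
  by rewrite mulf_eq0 gt_eqF //= subr_eq0 => /eqP.
by rewrite -s2 sqrtr_sqr ger0_norm // mulr_ge0 // ltW.
Qed.

Definition third_lim : R := 3 * Num.sqrt 3 / (2 * pi).

Lemma third_lim_gt0 : 0 < third_lim.
Proof. by rewrite /third_lim divr_gt0 ?mulr_gt0 ?pi_gt0 ?sqrtr_gt0. Qed.

Lemma third_prod_prim m :
  third_prim m (pi / 2) * third_prod m = third_lim * zero_prim m (pi / 2).
Proof.
have p0 := lt0r_neq0 (pi_gt0 R).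
rewrite /third_prim /zero_prim !cos_prim_pihalf /third_prod.
have -> : 2 / 3 * (pi / 2) = pi / 3 :> R by field.
have -> : 3 / 2 * sin (pi / 3) = third_lim * (pi / 2) :> R.
  rewrite /third_lim -sin_pi3; move: (sin _) => s; move: (@pi R) p0 => y y0.
  by field.
move: third_lim => c; rewrite -!mulrA -big_split; do 3!congr (_ * _); apply: eq_bigr => j _ /=.
have key (x y : R) : 0 <= x -> 2 * (x + 1) * y / ((2 * (x + 1)) ^+ 2 - (2 / 3) ^+ 2)
    * (1 - (9 * (x + 1) ^+ 2)^-1) = 2 * (x + 1) * y / ((2 * (x + 1)) ^+ 2 - 0 ^+ 2).
  by move=> x0; field; do ?[apply/andP; split]; apply: lt0r_neq0; nra.
by rewrite -mul2n natrM -[j.+1%:R]natr1; apply: key.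
Qed.

(** With z and t the values of [zero_prim] and [third_prim] at index m + 2, the product is
    [third_lim] times z / t. The Wallis step (2m + 3) z' = (2m + 4) z, z' being the preceding value,
    turns [zero_prim_bounds] into 1 <= z / t <= (2m + 3) / (2m + 1). *)
Lemma third_prodP m : third_lim <= third_prod m.+2 <= third_lim + 2 * third_lim / m.*2.+1%:R.
Proof.
have c0 := third_lim_gt0.
have := zero_prim_bounds m.+1; have := third_prod_prim m.+2.
have zS : zero_prim m.+1 (pi / 2) * m.*2.+3%:R = zero_prim m.+2 (pi / 2) * m.*2.+4%:R.
  rewrite /zero_prim !cos_prim_pihalf [in RHS]big_ord_recr /= expr0n subr0.
  have : (m.+1.*2.+2)%:R != 0 :> R by rewrite pnatr_eq0.
  by rewrite !doubleS => ?; field.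
have z0 : 0 < zero_prim m.+2 (pi / 2).
  rewrite /zero_prim cos_prim_pihalf mulr_gt0 ?divr_gt0 ?pi_gt0 // prodr_gt0 // => j _.
  by rewrite expr0n subr0 divr_gt0 ?exprn_gt0 ?mulr_gt0 ?ltr0n.
move: zS z0.
move: (zero_prim _ _) (third_prim _ _) (third_prod _) (zero_prim _ _) => z t p z1.
move: third_lim c0 => c c0 zS z0 tp /= /andP[zt tz].
move: zS; rewrite -[m.*2.+4]addn4 -[m.*2.+3]addn3 -[m.*2.+1]addn1 !natrD.
have : 0 <= m.*2%:R :> R by []; move: (m.*2%:R) => N N0 zS.
have d : (z1 - z) * (N + 3) = z by rewrite mulrBl; lra.
have t1 : z * (N + 1) <= t * (N + 3).
  have : (z - t) * (N + 3) <= 2 * (z1 - z) * (N + 3) by rewrite ler_wpM2r //; lra.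
  by rewrite -mulrA d; lra.
have t0 : 0 < t.
  by rewrite -(pmulr_lgt0 _ (_ : 0 < N + 3)) ?(lt_le_trans _ t1) ?mulr_gt0 //; lra.
have cp : c <= p by rewrite -(ler_pM2l t0) tp mulrC ler_pM2l //; lra.
rewrite cp /=; have -> : c + 2 * c / (N + 1) = c * (N + 3) / (N + 1).
  by field; apply: lt0r_neq0; lra.
rewrite ler_pdivlMr; last by lra.
rewrite -(ler_pM2l z0).
have -> : z * (c * (N + 3)) = t * (N + 3) * p by rewrite mulrAC tp; ring.
by rewrite mulrCA [X in X <= _]mulrC ler_wpM2r //; lra.
Qed.

Lemma third_prod_cvg : third_prod m @[m --> \oo] --> third_lim.
Proof.
rewrite -(cvg_shiftn 2); apply: (@squeeze_cvgr _ _ _ _ (fun=> third_lim)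
  (fun m => third_lim + 2 * third_lim / m.*2.+1%:R)).
- by near=> m; rewrite /= addn2 third_prodP.
- exact: cvg_cst.
rewrite -[X in _ --> X]addr0 -[X in _ --> _ + X](mulr0 (2 * third_lim)).
apply: cvgD; first exact: cvg_cst.
apply: cvgMr; apply: (@squeeze_cvgr _ _ _ _ (fun=> 0) harmonic).
- near=> m; rewrite /= invr_ge0 ler0n /= lef_pV2 ?posrE ?ltr0n // ler_nat.
  by rewrite ltnS -addnn leq_addr.
- exact: cvg_cst.
- exact: cvg_harmonic.
Unshelve. all: by end_near.
Qed.

End SineProduct.

(** * Asymptotics of the Franel numbers *)

Section Asymptotics.
Variable R : realType.
Implicit Types (u v : R^nat).

Lemma cvg0_half_contraction u v : (forall n, 0 <= u n) ->
  (forall n, u n.+1 <= u n / 2 + v n) -> v @ \oo --> 0 -> u @ \oo --> 0.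
Proof.
move=> u0 uS /cvgr0Pnorm_le v0; apply/cvgr0Pnorm_le => e e0.
have [|N _ vN] := v0 (e / 4); first by rewrite divr_gt0.
have le j : u (N + j)%N <= e / 2 + u N * (1 / 2) ^+ j.
  elim: j => [|j IH]; first by rewrite addn0 expr0 mulr1 lerDr ltW // divr_gt0.
  rewrite addnS; apply: le_trans (uS _) _; rewrite exprSr.
  have := vN (N + j)%N (leq_addr _ _); rewrite ler_norml => /andP[_].
  by move: IH; lra.
have half1 : `|1 / 2 : R| < 1 by rewrite ger0_norm; lra.
have [|J _ uJ] := (cvgr0Pnorm_le _).1 (cvg_geometric (u N) half1) (e / 2).
  by rewrite divr_gt0.
exists (N + J)%N => // n /= Nn; have := le (n - N)%N.
rewrite subnKC; last by rewrite (leq_trans _ Nn) // leq_addr.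
have := uJ (n - N)%N; rewrite /= leq_subRL ?(leq_trans (leq_addr J N)) // => /(_ Nn).
have p0 : 0 <= (1 / 2 : R) ^+ (n - N) by rewrite exprn_ge0 //; lra.
rewrite !ger0_norm ?mulr_ge0 //; move: (u n) (u N * _) => x y; lra.
Qed.

Lemma cvg_nat_half : n%:R * (1 / 2) ^+ n @[n --> \oo] --> (0 : R).
Proof.
apply: (@cvg0_half_contraction _ (fun n => (1 / 2) ^+ n.+1)).
- by move=> n; rewrite mulr_ge0 // exprn_ge0 //; lra.
- by move=> n; rewrite -natr1 exprSr; lra.
rewrite (cvg_shiftS (fun n => (1 / 2 : R) ^+ n)); apply: cvg_expr.
by rewrite ger0_norm; lra.
Qed.

(** (3k)! / (27^k k!^3) is the product of (3j - 2)(3j - 1) / (9 j^2), and [third_prod] that of (3j -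
    1)(3j + 1) / (9 j^2); the quotient of the two telescopes, and at k + 1 it is 1 / (3k + 4). *)
Lemma trinomial_ratioE k :
  trinomial_ratio R k = third_prod R k.+1 * (1 / 3 - 1 / 3 / (3 * k%:R + 4)).
Proof.
have p (j : nat) : 0 <= j%:R :> R by [].
have nz : 3 * k%:R + 4 != 0 :> R by rewrite lt0r_neq0 // ltr_wpDl ?mulr_ge0.
suff E : trinomial_ratio R k * (3 * k%:R + 4) = k.+1%:R * third_prod R k.+1.
  apply: (mulIf nz); rewrite E -[k.+1%:R]natr1; move: (third_prod R k.+1) => t.
  by field.
elim: k {nz} => [|k IH].
  rewrite /third_prod big_ord1 /trinomial_ratio /trinomial /= !expr1n.
  by rewrite (_ : (3 * 1)`! = 6)%N // expr1; field.
rewrite /third_prod big_ord_recr /= -/(third_prod R k.+1).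
have E := trinomialS R k.+1; rewrite /trinomial_ratio in IH *.
move: IH E; rewrite (exprS 27 k.+1) -[k.+2%:R]natr1 -[k.+1%:R]natr1.
have := p k; have : 27 ^+ k.+1 != 0 :> R by rewrite expf_neq0 ?pnatr_eq0.
move: (trinomial R k.+2) (trinomial R k.+1) (27 ^+ _) (third_prod R k.+1) k%:R.
move=> t2 t1 q s x q0 x0 E1 E2.
have x1 : x + 1 != 0 by rewrite lt0r_neq0 //; lra.
have x2 : (x + 1 + 1) ^+ 3 != 0 by rewrite expf_neq0 // lt0r_neq0 //; lra.
have -> : s = t1 / q * (3 * x + 4).
  by apply: (mulfI x1); rewrite -E1; field.
have -> : t2 = (3 * (x + 1) + 1) * (3 * (x + 1) + 2) * (3 * (x + 1) + 3) * t1 / (x + 1 + 1) ^+ 3.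
  by rewrite -E2 mulrC mulKf.
by field; rewrite q0 andbT; apply: lt0r_neq0; lra.
Qed.

Lemma trinomial_ratio_cvg : trinomial_ratio R k @[k --> \oo] --> third_lim R / 3.
Proof.
under eq_cvg do rewrite trinomial_ratioE.
apply: cvgM; first by rewrite (cvg_shiftS (third_prod R)); exact: third_prod_cvg.
rewrite [X in _ --> X](_ : _ = 1 / 3 - 1 / 3 * 0); last by rewrite mulr0 subr0 mul1r.
apply: cvgB; first exact: cvg_cst.
apply: cvgMl_tmp; apply: (@squeeze_cvgr _ _ _ _ (fun=> 0) harmonic).
- near=> k; have k0 : 0 <= k%:R :> R by [].
  rewrite /= -[k.+1%:R]natr1 invr_ge0 lef_pV2 ?posrE; lra.
- exact: cvg_cst.
- exact: cvg_harmonic.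
Unshelve. all: by end_near. Qed.

(** After rescaling, [log_sum_rec] reads a(n+1) = (n + 1) / (4n) a(n) + 1 + o(1), whose limiting
    fixed point is 4/3. Starting the index at 1 keeps the contraction factor at most 1/2. *)
Lemma log_sum_cvg : log_sum R n * (n%:R / 8 ^+ n) @[n --> \oo] --> (4 / 3 : R).
Proof.
rewrite -cvg_shiftS -subr_cvg0; apply/norm_cvg0P.
apply: (@cvg0_half_contraction _ (fun n => n.+1%:R^-1 + 5 * (1 / 2) ^+ n)); last first.
- rewrite -[X in _ --> X]addr0 -[X in _ --> _ + X](mulr0 5).
  apply: cvgD; first exact: cvg_harmonic.
  by apply: cvgMl_tmp; apply: cvg_expr; rewrite ger0_norm; lra.
- move=> n /=; set a := log_sum R n.+1 * _; set h : R := (1 / 2) ^+ n.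
  have h0 : 0 <= h by rewrite exprn_ge0 //; lra.
  have h1 : h <= 1 by rewrite exprn_ile1 //; lra.
  set s : R := (- 1) ^+ n; have s1 : `|s| = 1 by rewrite normrX normrN1 expr1n.
  have h8 : 8 ^+ n * h ^+ 3 = 1.
    by rewrite /h -exprM mulnC exprM -exprMn (_ : 8 * _ = 1) ?expr1n //; field.
  have h2 : 2 ^+ n = 8 ^+ n * h ^+ 2.
    by rewrite /h -exprM mulnC exprM -exprMn; congr (_ ^+ _); field.
  have x0 : 0 <= n%:R :> R by [].
  have -> : log_sum R n.+2 * (n.+2%:R / 8 ^+ n.+2) - 4 / 3 =
      (n%:R + 2) / (4 * (n%:R + 1)) * (a - 4 / 3) + 1 / (3 * (n%:R + 1))
      + (s * h ^+ 3 / 32 - 3 * h ^+ 2 / 16).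
    have := log_sum_rec R n.+1; rewrite !(exprSr 8) !(exprSr 2) !(exprSr (- 1)) h2 -/s /a !(exprSr 8).
    rewrite -[n.+2%:R]natr1 -[n.+1%:R]natr1.
    have e0 : 8 ^+ n != 0 :> R by rewrite expf_neq0 ?pnatr_eq0.
    have -> : h ^+ 3 = (8 ^+ n)^-1 by apply: (mulfI e0); rewrite h8 divff.
    move: (log_sum R n.+2) (log_sum R n.+1) (8 ^+ n) n%:R e0 x0 => L2 L1 e x e0 x0 E.
    have x1 : x + 1 != 0 by rewrite lt0r_neq0 //; lra.
    have x2 : x + 1 + 1 != 0 by rewrite lt0r_neq0 //; lra.
    have -> : L2 = 2 * L1 + (e * 8 * 8 + 2 * (s * -1 * -1) - 3 * (e * h ^+ 2 * 2 * 2)) / (x + 1 + 1).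
      by rewrite -E; field.
    by field; rewrite e0 x1 x2.
  have /andP[c0 c1] : 0 <= (n%:R + 2 : R) / (4 * (n%:R + 1)) <= 1 / 2.
    by rewrite divr_ge0 /= ?ler_pdivrMr; lra.
  apply: le_trans (ler_normD _ _) _; apply: le_trans (lerD (ler_normD _ _) (lexx _)) _.
  rewrite -addrA; apply: lerD.
    by rewrite normrM mulrC ler_wpM2l // ger0_norm //; lra.
  apply: lerD.
    have n3 : 0 < 3 * (n%:R + 1) :> R by lra.
    rewrite ger0_norm; last by rewrite divr_ge0 // ltW.
    by rewrite div1r -[n.+1%:R]natr1 lef_pV2 ?posrE; lra.
  apply: le_trans (ler_normB _ _) _; rewrite -mulrA normrM s1 mul1r.
  rewrite !ger0_norm ?divr_ge0 ?mulr_ge0 ?exprn_ge0 //; move: h h0 h1 {h8 h2 a s s1} => h h0 h1.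
  by rewrite -/h !exprS expr0; nra.
- by move=> n; exact: normr_ge0.
Qed.

(* Silverman-Toeplitz, with total mass tending to [b]. *)
Lemma cvg_toeplitz_mean (s : R^nat) (w : nat -> R^nat) (a b : R) :
    (forall n k, 0 <= w n k) -> s @ \oo --> a ->
    (forall k, w n k @[n --> \oo] --> 0) ->
    \sum_(k < n.+1) w n k @[n --> \oo] --> b ->
  \sum_(k < n.+1) s k * w n k @[n --> \oo] --> a * b.
Proof.
move=> w0 sa wk sw; suff d0 : \sum_(k < n.+1) (s k - a) * w n k @[n --> \oo] --> 0.
  rewrite -[X in _ --> X]add0r.
  suff E : (fun n => \sum_(k < n.+1) s k * w n k) =
      (fun n => \sum_(k < n.+1) (s k - a) * w n k + a * \sum_(k < n.+1) w n k).
    by rewrite E; apply: cvgD => //; exact: cvgMl_tmp.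
  apply/funext => n; rewrite mulr_sumr -big_split /=.
  by apply: eq_bigr => k _; rewrite -mulrDl subrK.
apply/cvgr0Pnorm_le => e e0.
have b1 : 0 < `|b| + 1 by rewrite ltr_wpDl.
have d : 0 < e / 2 / (`|b| + 1) by rewrite !divr_gt0.
have [K _ sK] : \forall k \near \oo, `|s k - a| <= e / 2 / (`|b| + 1).
  by apply: (cvgr0Pnorm_le (fun k => s k - a)).1 => //; exact/subr_cvg0.
have head0 : \sum_(k < K) `|s k - a| * w n k @[n --> \oo] --> 0.
  elim: (K) => [|j IH]; first by under eq_cvg do rewrite big_ord0; exact: cvg_cst.
  under eq_cvg do rewrite big_ord_recr /=.
  have := cvgD IH (cvgM (cvg_cst `|s j - a|) (wk j)).
  by rewrite mulr0 addr0; exact.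
near=> n.
have nK : (K <= n.+1)%N by near: n; exists K => // m /=; exact: leqW.
have hn : `|\sum_(k < K) `|s k - a| * w n k| <= e / 2.
  by near: n; apply: (cvgr0Pnorm_le _).1 => //; rewrite divr_gt0.
have wn : \sum_(k < n.+1) w n k <= `|b| + 1.
  near: n; apply: (cvgr_le _ sw); by rewrite (le_lt_trans (ler_norm b)) // ltrDl.
apply: le_trans (ler_norm_sum _ _ _) _.
apply: (@le_trans _ _ (\sum_(k < K) `|s k - a| * w n k +
    e / 2 / (`|b| + 1) * \sum_(k < n.+1) w n k)).
  rewrite (big_ord_widen n.+1 (fun k => `|s k - a| * w n k)) //.
  rewrite [X in _ <= X + _]big_mkcond mulr_sumr -big_split.
  apply: ler_sum => k _ /=; rewrite normrM (ger0_norm (w0 _ _)).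
  case: ltnP => kK; first by rewrite lerDl mulr_ge0 // ltW.
  by rewrite add0r ler_wpM2r // sK.
rewrite [leRHS]splitr; apply: lerD; first by apply: le_trans hn; exact: ler_norm.
by rewrite -[leRHS](divfK (lt0r_neq0 b1)) ler_wpM2l // ltW.
Unshelve. all: by end_near. Qed.

Lemma bin_le_exp2 m k : ('C(m, k) <= 2 ^ m)%N.
Proof.
elim: m k => [|m IH] [|k]; rewrite ?bin0 ?expn_gt0 ?bin0n //.
by rewrite binS expnS mul2n -addnn leq_add.
Qed.

Lemma ratio27_ge0 : 0 <= ratio27 R.
Proof. by rewrite /ratio27; lra. Qed.

Lemma log_term_ge0 n k : 0 <= log_term R n k.
Proof. by rewrite !mulr_ge0 ?invr_ge0 ?exprn_ge0 ?ratio27_ge0. Qed.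

(** For fixed k the binomial is at most 2^(n+1+k), so the term is O(4^n). *)
Lemma log_term_cvg0 k : log_term R n k * (n%:R / 8 ^+ n) @[n --> \oo] --> (0 : R).
Proof.
set c : R := ratio27 R ^+ k.+1 / k.+1%:R * 2 ^+ k.+1.
apply: (@squeeze_cvgr _ _ _ _ (fun=> 0) (fun n => c * (n%:R * (1 / 2) ^+ n))).
- near=> n; have -> /= : 0 <= log_term R n k * (n%:R / 8 ^+ n).
    by rewrite mulr_ge0 ?log_term_ge0 ?divr_ge0 ?exprn_ge0.
  have -> : n%:R * (1 / 2) ^+ n = 2 ^+ n * 2 ^+ n * (n%:R / 8 ^+ n) :> R.
    have -> : 8 ^+ n = 2 ^+ n * 2 ^+ n * 2 ^+ n :> R.
      by rewrite -!exprMn; congr (_ ^+ _); ring.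
    have : 2 ^+ n != 0 :> R by rewrite expf_neq0 ?pnatr_eq0.
    by rewrite expr_div_n expr1n; move: (2 ^+ n) n%:R => x y x0; field.
  rewrite [leRHS]mulrA ler_wpM2r ?divr_ge0 ?exprn_ge0 //.
  rewrite [leRHS]mulrA /log_term ler_wpM2r ?exprn_ge0 // /c -[leRHS]mulrA ler_wpM2l //.
    by rewrite divr_ge0 // exprn_ge0 // ratio27_ge0.
  by rewrite -exprD -natrX ler_nat addnC addnS -addSn; exact: bin_le_exp2.
- exact: cvg_cst.
- by rewrite -[X in _ --> X](mulr0 c); apply: cvgMl_tmp; exact: cvg_nat_half.
Unshelve. all: by end_near. Qed.

Lemma franel_cvg :
  (franel n)%:R * (n%:R / 8 ^+ n) @[n --> \oo] --> 4 / 9 * third_lim R.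
Proof.
under eq_cvg do rewrite franel_log_sum mulrDl mulr_suml.
have -> : 4 / 9 * third_lim R = 0 + third_lim R / 3 * (4 / 3) by field.
apply: cvgD.
  apply: (@squeeze_cvgr _ _ _ _ (fun=> 0) (fun n => n%:R * (1 / 2) ^+ n)).
  - near=> n; rewrite !mulr_ge0 ?invr_ge0 ?exprn_ge0 //=.
    rewrite mulrCA ler_wpM2l // ler_pdivrMr ?exprn_gt0 // -exprMn.
    by apply: lerXn2r; rewrite ?nnegrE; lra.
  - exact: cvg_cst.
  - exact: cvg_nat_half.
under eq_cvg do under eq_bigr do rewrite -mulrA.
apply: (@cvg_toeplitz_mean _ (fun n k => log_term R n k * (n%:R / 8 ^+ n))).
- by move=> n k; rewrite mulr_ge0 ?log_term_ge0 ?divr_ge0 ?exprn_ge0.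
- exact: trinomial_ratio_cvg.
- exact: log_term_cvg0.
- by under eq_cvg do rewrite -mulr_suml; exact: log_sum_cvg.
Unshelve. all: by end_near. Qed.

End Asymptotics.

(** * Growth of the solution with initial values 1, 1 *)

Section DominantSolution.
Variables (R : realType) (e : R^nat).
Hypotheses (e0 : e 0%N = 1) (e1 : e 1%N = 1).
Hypothesis e_rec : forall n, (n%:R + 8) * (n%:R + 7) * e n.+2 =
  8 * (n%:R + 3) * (n%:R + 1) * e n + (7 * n%:R ^+ 2 + 53 * n%:R + 88) * e n.+1.

(** By the recurrence, e(n+2) / e(n+1) is a decreasing function of e(n+1) / e(n), so the lower bound
    yields the next upper bound and the upper bound the next lower one. *)
Lemma recurrence_ratio_bounds n :
  [/\ 0 < e n, 0 < e n.+1, e n.+1 <= 8 * e n & 8 * n%:R * e n <= (n%:R + 8) * e n.+1].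
Proof.
elim: n => [|n [p0 p1 up lo]]; first by rewrite e0 e1; split; lra.
have n1 : (0 < n)%N -> 1 <= n%:R :> R by rewrite ler1n.
have n0 : n = 0%N -> e n.+1 = e n by move=> ->; rewrite e0 e1.
have n00 : n = 0%N -> n%:R = 0 :> R by move=> ->.
have := e_rec n; rewrite -[n.+1%:R]natr1; have : 0 <= n%:R :> R by [].
move: (e n) (e n.+1) (e n.+2) p0 p1 up lo n0 => x y z x0 y0 up lo n0 xn0 E.
have q : 0 < (n%:R + 8) * (n%:R + 7) :> R by rewrite mulr_gt0 //; lra.
(* At [n = 0] the lower bound is vacuous and cannot give the next upper bound; there the equality of
   the two initial values is used. *)
have [nz|npos] := posnP n.
  move: (n0 nz) (n00 nz) => n0' n00'; rewrite n00' in E *; split=> //; nra.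
have {n0 n00} := n1 npos; move: (n%:R) xn0 lo E q {n1} => t t0 lo E q t1.
have z0 : 0 < z.
  by rewrite -(pmulr_rgt0 _ q) E addr_gt0 // mulr_gt0 //; nra.
split=> //.
- rewrite -(ler_pM2l q) E -(ler_pM2l (lt_le_trans ltr01 t1)).
  have h : 0 <= (t + 3) * (t + 1) by nra.
  have := ler_wpM2l h lo; nra.
- have q2 : 0 < (t + 7) :> R by lra.
  rewrite -(ler_pM2l q) (mulrCA _ (t + 1 + 8)) E.
  have h : 0 <= (t + 3) * (t + 1) by nra.
  have := ler_wpM2l h up; nra.
Qed.

Lemma recurrence_ratio_cvg : e n.+1 / e n @[n --> \oo] --> (8 : R).
Proof.
apply: (@squeeze_cvgr _ _ _ _ (fun n => 8 - 64 * n.+1%:R^-1) (fun=> 8)).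
- near=> n; have [x0 y0 up lo] := recurrence_ratio_bounds n.
  rewrite ler_pdivlMr // ler_pdivrMr // up andbT.
  have t0 : 0 <= n%:R :> R by []; have t1 : n%:R + 1 != 0 :> R by rewrite lt0r_neq0; lra.
  rewrite -[n.+1%:R]natr1; move: n%:R lo t0 t1 => t lo t0 t1.
  have t8 : 0 < t + 8 by lra.
  rewrite -(ler_pM2l t8); apply: le_trans lo; rewrite mulrA; apply: ler_wpM2r; first exact: ltW.
  rewrite (_ : 8 * t = (t + 8) * (8 - 64 * (t + 1)^-1) + 448 * (t + 1)^-1); last by field.
  by rewrite lerDl divr_ge0 ?ler0n // addr_ge0.
- rewrite -[X in _ --> X]subr0 -[X in _ --> _ - X](mulr0 64); apply: cvgB; first exact: cvg_cst.
  by apply: cvgMl_tmp; exact: cvg_harmonic.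
- exact: cvg_cst.
Unshelve. all: by end_near. Qed.

Variables (f : R^nat) (c : R).
Hypothesis f_cvg : f n * (n%:R / 8 ^+ n) @[n --> \oo] --> c.
Hypothesis f_e : forall n, let m := n%:R + 3 in 15 * f (n + 5)%N =
  (m - 2) * m * (3 * m ^+ 4 + 28 * m ^+ 3 + 85 * m ^+ 2 + 88 * m + 20) * e n
  + (m + 3) * (m + 4) * (3 * m ^+ 4 + 13 * m ^+ 3 + 10 * m ^+ 2 - 7 * m - 5) * e n.+1.

Lemma recurrence_cvg :
  e n * (n%:R ^+ 7 / 8 ^+ n) @[n --> \oo] --> 15 * 8 ^+ 5 * c / 27.
Proof.
pose y n : R := n%:R^-1.
have y0 : y n @[n --> \oo] --> (0 : R).
  by rewrite -cvg_shiftS; exact: cvg_harmonic.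
have py0 (p : {poly R}) : p.[y n] @[n --> \oo] --> p.[0].
  apply: (@cvg_comp _ _ _ y (horner p) _ _ _ y0); exact: continuous_horner.
(* The right-hand side of [f_e] times n + 5, divided by n^7 e(n), as a function of x = 1/n and of
   the ratio r. The factor 1 + 5x comes from the normalization of f at n + 5. At x = 0 and r = 8 its
   value is 3 + 3 * 8 = 27. *)
pose d x r : R := (Poly [:: 1; 5]).[x] *
  ((Poly [:: 1; 1]).[x] * (Poly [:: 1; 3]).[x] * (Poly [:: 3; 64; 499; 1678; 2048]).[x]
   + (Poly [:: 1; 6]).[x] * (Poly [:: 1; 7]).[x] * (Poly [:: 3; 49; 289; 728; 658]).[x] * r).
have d27 : d (y n) (e n.+1 / e n) @[n --> \oo] --> (27 : R).
  have <- : d 0 8 = 27 by rewrite /d !horner_Poly /= !mulr0 !add0r; ring.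
  exact: (cvgM (py0 (Poly [:: 1; 5])) (cvgD
    (cvgM (cvgM (py0 (Poly [:: 1; 1])) (py0 (Poly [:: 1; 3])))
          (py0 (Poly [:: 3; 64; 499; 1678; 2048])))
    (cvgM (cvgM (cvgM (py0 (Poly [:: 1; 6])) (py0 (Poly [:: 1; 7])))
          (py0 (Poly [:: 3; 49; 289; 728; 658]))) recurrence_ratio_cvg))).
have f5 : f (n + 5)%N * ((n + 5)%:R / 8 ^+ (n + 5)) @[n --> \oo] --> c.
  by rewrite (cvg_shiftn 5 (fun n => f n * (n%:R / 8 ^+ n))).
have n27 : 27 != 0 :> R by rewrite pnatr_eq0.
have -> : 15 * 8 ^+ 5 * c / 27 = 15 * 8 ^+ 5 * (c / 27) by rewrite mulrA.
have L : 15 * 8 ^+ 5 * (f (n + 5)%N * ((n + 5)%:R / 8 ^+ (n + 5)) / d (y n) (e n.+1 / e n))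
    @[n --> \oo] --> 15 * 8 ^+ 5 * (c / 27).
  by apply: cvgM; [exact: cvg_cst | apply: cvgM f5 _; exact: cvgV].
apply: (cvg_trans _ L); apply: near_eq_cvg; near=> n.
have n0 : n%:R != 0 :> R by rewrite pnatr_eq0 -lt0n; near: n; exists 1%N.
have dn0 : d (y n) (e n.+1 / e n) != 0 by near: n; exact: cvgr_neq0 d27 n27.
have [x0 _ _ _] := recurrence_ratio_bounds n.
have dE : d (y n) (e n.+1 / e n) * (n%:R ^+ 7 * e n) = (n%:R + 5) * (15 * f (n + 5)%N).
  rewrite f_e /d /y !horner_Poly /=.
  move: (e n) (e n.+1) n%:R x0 n0 {dn0} => x z t /lt0r_neq0 x0 n0.
  by field; rewrite x0.
rewrite exprD natrD; move: n0 dn0 dE; have : 0 <= n%:R :> R by [].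
have : 8 ^+ n != 0 :> R by rewrite expf_neq0 ?pnatr_eq0.
move: (d (y n) (e n.+1 / e n)) => D; move: (8 ^+ n) (f _) (e n) n%:R {x0} => E F x t E0 t0 n0 D0 dE.
have t5 : t + 5 != 0 by rewrite lt0r_neq0 // ltr_wpDl.
have -> : F = D * (t ^+ 7 * x) / (15 * (t + 5)) by rewrite dE; field.
by field; rewrite E0 t5 D0.
Unshelve. all: by end_near. Qed.

End DominantSolution.

(** * Recurrence, differential equation and equivalent of [E3] *)

Lemma E3_chamber_count n : (E3 n)%:Z = chamber_count n 0 0.
Proof. by rewrite E3_completions completions_nil. Qed.

Lemma E3_01 : E3 0 = 1%N /\ E3 1 = 1%N.
Proof. by rewrite !E3_completions /= big_ord0 big_mkcond big_ord_recr big_ord0. Qed.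

Lemma E3_rec n :
  8 * (n%:Z + 3) * (n%:Z + 1) * (E3 n)%:Z
  + (7 * n%:Z ^+ 2 + 53 * n%:Z + 88) * (E3 n.+1)%:Z
  - (n%:Z + 8) * (n%:Z + 7) * (E3 n.+2)%:Z = 0.
Proof. by rewrite !E3_chamber_count; case: (chamber_count_elimination n). Qed.

Section FpsMul.
Variable R : comNzRingType.
Implicit Types (p q : {poly R}) (a : fps R).

Lemma fps_mulB p q a m :
  fps_mul (fps_poly (p - q)) a m = fps_mul (fps_poly p) a m - fps_mul (fps_poly q) a m.
Proof.
by rewrite /fps_mul -sumrB; apply: eq_bigr => i _; rewrite /fps_poly coefB mulrBl.
Qed.

Lemma fps_mulMn p c a m :
  fps_mul (fps_poly (p *+ c)) a m = fps_mul (fps_poly p) a m *+ c.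
Proof.
by rewrite /fps_mul -sumrMnl; apply: eq_bigr => i _; rewrite /fps_poly coefMn mulrnAl.
Qed.

Lemma fps_mulXn k a m :
  fps_mul (fps_poly 'X^k) a m = if (k <= m)%N then a (m - k)%N else 0.
Proof.
rewrite /fps_mul /fps_poly; case: leqP => km.
  rewrite (bigD1 (inord k)) //= inordK // coefXn eqxx mul1r big1 ?addr0 // => i.
  by rewrite -val_eqE /= inordK // coefXn => /negbTE ->; rewrite mul0r.
rewrite big1 // => i _; rewrite coefXn; case: eqP (ltn_ord i) => [->|]; last by rewrite mul0r.
by rewrite ltnS leqNgt km.
Qed.

End FpsMul.

(** For m >= 2 the coefficient of t^m is the opposite of the left-hand side of [E3_rec] at m - 2;
    for m = 0 and 1 the initial values and the constant 30 settle it. *)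
Lemma E3_gf_ode :
  fps_mul (fps_poly ('X^2 * (1 + 'X) * (1 - 8 * 'X)))
          (fps_deriv (fps_deriv E3_gf))
  \+ fps_mul (fps_poly (2 * 'X * (6 - 23 * 'X - 20 * 'X^2)))
             (fps_deriv E3_gf)
  \+ fps_mul (fps_poly (6 * (5 - 7 * 'X - 4 * 'X^2))) E3_gf
  \- fps_poly 30 =1 (fun=> 0).
Proof.
have -> : 'X^2 * (1 + 'X) * (1 - 8 * 'X) = 'X^2 - 'X^3 *+ 7 - 'X^4 *+ 8 :> {poly int} by ring.
have -> : 2 * 'X * (6 - 23 * 'X - 20 * 'X^2) = 'X^1 *+ 12 - 'X^2 *+ 46 - 'X^3 *+ 40 :> {poly int}.
  by ring.
have -> : 6 * (5 - 7 * 'X - 4 * 'X^2) = 'X^0 *+ 30 - 'X^1 *+ 42 - 'X^2 *+ 24 :> {poly int}.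
  by ring.
move=> m /=; rewrite !(fps_mulB, fps_mulMn, fps_mulXn) /fps_poly coefMn coef1.
rewrite /fps_deriv /E3_gf; have [e0 e1] := E3_01; have := E3_rec (m - 2).
(* The monomials of degree 3 and 4 contribute only from m = 3 and m = 4 on, hence the separate small
   cases. *)
case: m => [|[|[|[|m]]]]; rewrite !(subSS, sub0n, subn0) /=.
- by rewrite e0.
- by rewrite e0 e1.
- move: (E3 0) (E3 1) (E3 2) => x y z /(congr1 -%R); rewrite oppr0 => h; rewrite -[RHS]h; ring.
- move: (E3 0) (E3 1) (E3 2) (E3 3) => x y z t /(congr1 -%R); rewrite oppr0 => h; rewrite -[RHS]h; ring.
move: (E3 m.+2) (E3 m.+3) (E3 m.+4) => x y z /(congr1 -%R); rewrite oppr0 => h; rewrite -[RHS]h.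
have natE k (u : int) : u *+ (k + m) = u * (k%:Z + m%:Z).
  by rewrite -mulr_natr natz PoszD.
rewrite !(natE 4) !(natE 3) !(natE 2) !(natE 1) (PoszD 2 m : m.+2%:Z = _).
ring.
Qed.

Lemma equiv_of_ratio_cvg (R : realType) (u w : R^nat) (a : R) : 0 < a ->
    (forall n, (0 < n)%N -> 0 < w n) -> u n / w n @[n --> \oo] --> a ->
  (u : nat -> R^o) ~_\oo ((fun n => a * w n) : nat -> R^o).
Proof.
move=> a0 w0 uw; apply/eqaddoP => eps eps0.
have ea : 0 < eps * a by rewrite mulr_gt0.
have h : \forall n \near \oo, `|u n / w n - a| <= eps * a.
  by apply: (cvgr0Pnorm_le (fun n => u n / w n - a)).1 => //; exact/subr_cvg0.
near=> n; have wn : 0 < w n by apply: w0; near: n; exists 1%N.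
rewrite /= (_ : (u - _) n = (u n / w n - a) * w n); last first.
  by rewrite mulrBl divfK ?lt0r_neq0.
rewrite !normrM (gtr0_norm wn) (gtr0_norm a0) mulrA ler_wpM2r ?(ltW wn) //.
by near: n; exact: h.
Unshelve. all: by end_near. Qed.

Lemma E3_equiv (R : realType) :
  (fun n : nat => (E3 n)%:R : R^o) ~_\oo
  (fun n : nat => 2 ^+ 16 * 5 / 3 ^+ 3 * (Num.sqrt 3 / pi)
                  * (8 ^+ n / n%:R ^+ 7) : R^o).
Proof.
have intR (x y : int) : x = y -> (x - y)%:~R = 0 :> R by move=> ->; rewrite subrr.
have [E0 E1] := E3_01.
(* The constant of [recurrence_cvg], with c the limit found in [franel_cvg]: 15 * 2^15 * (4/9) *
   (3/2) = 5 * 2^16. *)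
have -> : 2 ^+ 16 * 5 / 3 ^+ 3 * (Num.sqrt 3 / pi) = 15 * 8 ^+ 5 * (4 / 9 * third_lim R) / 27 :> R.
  rewrite /third_lim; have := lt0r_neq0 (pi_gt0 R).
  by move: pi (Num.sqrt 3) => p s p0; field.
apply: equiv_of_ratio_cvg.
- have l0 := third_lim_gt0 R; rewrite divr_gt0 ?ltr0n //.
  rewrite mulr_gt0 ?(mulr_gt0 _ l0) ?divr_gt0 ?mulr_gt0 ?exprn_gt0 ?ltr0n //.
- by move=> n n0; rewrite divr_gt0 ?exprn_gt0 ?ltr0n.
under eq_cvg do rewrite invf_div.
apply: (@recurrence_cvg R (fun n => (E3 n)%:R) _ _ _ (fun n => (franel n)%:R)).
- by rewrite E0.
- by rewrite E1.
- move=> n; have := intR _ _ (esym (E3_rec n)); move: (E3 n) (E3 n.+1) (E3 n.+2) => x y z h.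
  by apply: subr0_eq; rewrite -[RHS]h; ring.
- exact: franel_cvg.
- move=> n m; have := intR _ _ (chamber_count_elimination n).2; rewrite -!E3_chamber_count.
  rewrite /m; move: (E3 n) (E3 n.+1) (franel (n + 5)) => x y z {m} h.
  by apply: subr0_eq; rewrite -[RHS]h /=; ring.
Qed.

Theorem proposition2 :
  [/\ E3 0 = 1%N /\ E3 1 = 1%N,
      forall n : nat,
        8 * (n%:Z + 3) * (n%:Z + 1) * (E3 n)%:Z
        + (7 * n%:Z ^+ 2 + 53 * n%:Z + 88) * (E3 n.+1)%:Z
        - (n%:Z + 8) * (n%:Z + 7) * (E3 n.+2)%:Z = 0,
      fps_mul (fps_poly ('X^2 * (1 + 'X) * (1 - 8 * 'X)))
              (fps_deriv (fps_deriv E3_gf))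
      \+ fps_mul (fps_poly (2 * 'X * (6 - 23 * 'X - 20 * 'X^2)))
                 (fps_deriv E3_gf)
      \+ fps_mul (fps_poly (6 * (5 - 7 * 'X - 4 * 'X^2))) E3_gf
      \- fps_poly 30 =1 (fun=> 0)
    & forall R : realType,
        (fun n : nat => (E3 n)%:R : R^o) ~_\oo
        (fun n : nat => 2 ^+ 16 * 5 / 3 ^+ 3 * (Num.sqrt 3 / pi)
                        * (8 ^+ n / n%:R ^+ 7) : R^o)].
Proof. by split; [exact: E3_01 | exact: E3_rec | exact: E3_gf_ode | exact: E3_equiv]. Qed.
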